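(* Let $(M^n,\mathfrak g)$ be a non-flat $\mathfrak g$-homogeneous space with $\mu^{\mathfrak g}\in\mathcal S_\beta\cap V^{\ge0}_{\beta^+}$. Let $\mu\in\mathcal O^H_{\mathfrak g}\cap V^{\ge0}_{\beta^+}$ with $\mathrm{scal}^\star(\mu)<0$. Then $$\|\mathrm{Ric}^\star_\mu\|\ \ge\ |\mathrm{scal}^\star(\mu)|\cdot\|\beta_{\mathfrak m}\|,$$ with equality if and only if $\mathrm{Ric}^\star_\mu=-\mathrm{scal}^\star(\mu)\cdot\beta_{\mathfrak m}$.
   Context: Homogeneous data. A connected Riemannian manifold is locally homogeneous if any two points have small open distance balls related by an isometry matching the points. A $\mathfrak g$-homogeneous space $(M^n,g,\mathfrak g)$ is a locally homogeneous space, complete or diffeomorphic to a disk $D^n$, with a Lie algebra $\mathfrak g$ of Killing fields on $M$ spanning every tangent space; $(M^n,\mathfrak g)$ if the metric is unspecified. $\mu^{\mathfrak g}$ is the Lie bracket of $\mathfrak g$ (bracket of vector fields), $G$ the simply connected Lie group with Lie algebra $\mathfrak g$, acting locally on $M$; a metric is $G$-invariant if $G$ acts by local isometries. $(M^n,\mathfrak g)$ is non-flat if it admits at least one non-flat $G$-invariant metric. Fix $p\in M$; $\mathfrak h=\{X\in\mathfrak g:X(p)=0\}$; $H\subset G$ is the isotropy subgroup at $p$ in the globally homogeneous case, and the connected Lie subgroup with Lie algebra $\mathfrak h$ otherwise. The canonical decomposition is $\mathfrak g=\mathfrak h\oplus\mathfrak m$, $\mathfrak m$ the orthogonal complement of $\mathfrak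 h$ with respect to the Killing form of $\mathfrak g$; $\mathfrak m$ is $\mathrm{Ad}(H)$-invariant and $\mathfrak m\cong T_pM$. Brackets. Fix a $G$-invariant background metric $\bar g$, with scalar product $\langle\cdot,\cdot\rangle$ on $\mathfrak m$, extended to $\mathfrak g$ by $\mathfrak h\perp\mathfrak m$ and $\langle Z_1,Z_2\rangle=-\mathrm{tr}((\nabla^{\bar g}Z_1)_p(\nabla^{\bar g}Z_2)_p)$ on $\mathfrak h$. On endomorphisms $\langle A,B\rangle=\mathrm{tr}(AB^t)$. $V(\mathfrak g)=\Lambda^2\mathfrak g^*\otimes\mathfrak g$ carries $\langle\mu,\eta\rangle=\sum_{i,j}\langle\mu(e_i,e_j),\eta(e_i,e_j)\rangle$ ($\{e_i\}$ an orthonormal basis of $\mathfrak g$), the action $(h\cdot\mu)(X,Y)=h\mu(h^{-1}X,h^{-1}Y)$ of $\mathrm{GL}(\mathfrak g)$, and its derivative $(\pi(A)\mu)(X,Y)=A\mu(X,Y)-\mu(AX,Y)-\mu(X,AY)$. $\mathrm{GL}(\mathfrak m)\subset\mathrm{GL}(\mathfrak g)$ by extending by the identity on $\mathfrak h$. $\mathrm{GL}^H(\mathfrak m)$ is the centralizer of $\mathrm{Ad}(H)|_{\mathfrak m}$ in $\mathrm{GL}(\mathfrak m)$, and $\mathcal O^H_{\mathfrak g}=\mathrm{GL}^H(\mathfrak m)\cdot\mu^{\mathfrak g}\subset V(\mathfrak g)$. Modified curvature. For $\mu\in\mathcal O^H_{\mathfrak g}$ write $\mu|_{\mathfrak m\wedge\mathfrak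 m}=\mu_{\mathfrak h}+\mu_{\mathfrak m}$ ($\mathfrak h$- and $\mathfrak m$-components). $\mathrm{Ric}^\star_\mu:=\mathrm M_{\mu_{\mathfrak m}}-\tfrac12\mathrm B_\mu\in\mathrm{Sym}(\mathfrak m)$, where $\langle\mathrm M_{\mu_{\mathfrak m}}X,X\rangle=-\tfrac12\sum_{i,j}\langle\mu_{\mathfrak m}(X,E_i),E_j\rangle^2+\tfrac14\sum_{i,j}\langle\mu_{\mathfrak m}(E_i,E_j),X\rangle^2$ ($\{E_i\}$ an orthonormal basis of $\mathfrak m$) and $\langle\mathrm B_\mu X,Y\rangle=\mathrm{tr}_{\mathfrak g}(\mathrm{ad}_\mu X\,\mathrm{ad}_\mu Y)$; $\mathrm{scal}^\star(\mu):=\mathrm{tr}\,\mathrm{Ric}^\star_\mu$. Strata. The moment map $\mathrm m:V(\mathfrak g)\setminus\{0\}\to\mathrm{Sym}(\mathfrak g)$ is $\langle\mathrm m(\mu),A\rangle=\|\mu\|^{-2}\langle\pi(A)\mu,\mu\rangle$ for all $A\in\mathrm{Sym}(\mathfrak g)$, with energy $\mathrm E=\|\mathrm m\|^2$. For $\beta=\mathrm m(\mu_C)$, $\mu_C$ a critical point of $\mathrm E$, the stratum $\mathcal S_\beta$ is the set of $\mu\ne0$ for which the negative gradient flow of $\mathrm E$ starting at $\mu$ converges to a critical point with moment map value in $\mathrm O(\mathfrak g)\cdot\beta=\{k\beta k^{-1}:k\in\mathrm O(\mathfrak g)\}$. The strata are $\mathrm{GL}(\mathfrak g)$-invariant and partition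 $V(\mathfrak g)\setminus\{0\}$. $\beta^+:=\beta+\|\beta\|^2\mathrm{Id}_{\mathfrak g}$; $V^{\ge0}_{\beta^+}$ is the sum of the eigenspaces of $\pi(\beta^+)$ on $V(\mathfrak g)$ with nonnegative eigenvalues. For non-flat $(M,\mathfrak g)$ with $\mu^{\mathfrak g}\in\mathcal S_\beta\cap V^{\ge0}_{\beta^+}$, $\beta$ preserves $\mathfrak m$, $\mathrm{tr}\,\beta|_{\mathfrak m}<0$, and $\beta_{\mathfrak m}:=b\cdot\beta|_{\mathfrak m}\in\mathrm{Sym}(\mathfrak m)$ with $b=(-\mathrm{tr}\,\beta|_{\mathfrak m})^{-1}$. *)

(* Defs.v *)
From HB Require Import structures.
From mathcomp Require Import all_boot all_order all_algebra.
From mathcomp Require Import all_classical all_reals all_analysis.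
From mathcomp Require Import ring.

Set Implicit Arguments.
Unset Strict Implicit.
Unset Printing Implicit Defensive.

Import Order.TTheory GRing.Theory Num.Theory.
Import numFieldNormedType.Exports.
Local Open Scope classical_set_scope.
Local Open Scope ring_scope.

(* [Ck k D f]: [f] has continuous iterated partial derivatives up to order [k]
   on [D]; only used for open [D]. *)
Fixpoint Ck (R : realType) (n : nat) (k : nat) (D : set 'rV[R]_n)
    (f : 'rV[R]_n -> R) : Prop :=
  (forall x, D x -> {for x, continuous f}) /\
  if k is k'.+1 then
    forall i : 'I_n,
      (forall x, D x -> derivable f x (delta_mx 0 i)) /\
      Ck k' D (fun x => 'D_(delta_mx 0 i) f x)
  else True.

Definition Cinfty (R : realType) (n : nat) (D : set 'rV[R]_n)
    (f : 'rV[R]_n -> R) : Prop := forall k, Ck k D f.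

Record chart (R : realType) (n : nat) (M : topologicalType) := Chart {
  dom : set M;
  cmap : M -> 'rV[R]_n;
  cinv : 'rV[R]_n -> M }.

Definition is_chart (R : realType) (n : nat) (M : topologicalType)
    (c : chart R n M) : Prop :=
  [/\ open (dom c), open (cmap c @` dom c),
      (forall x, dom c x -> cinv c (cmap c x) = x),
      (forall x, dom c x -> {for x, continuous (cmap c)})
    & (forall y, (cmap c @` dom c) y -> {for y, continuous (cinv c)})].

Definition compatible (R : realType) (n : nat) (M : topologicalType)
    (c c' : chart R n M) : Prop :=
  forall i : 'I_n,
    Cinfty (cmap c @` (dom c `&` dom c')) (fun y => cmap c' (cinv c y) 0 i).

Record manifold (R : realType) (n : nat) := Manifold {
  carrier :> topologicalType;
  atlas : set (chart R n carrier);
  manifold_hausdorff : hausdorff_space carrier;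
  manifold_second_countable : @second_countable carrier;
  manifold_cover : forall x : carrier, exists2 c, atlas c & dom c x;
  manifold_charts : forall c, atlas c -> is_chart c;
  manifold_compatible :
    forall c c', atlas c -> atlas c' -> compatible c c' }.

Definition smooth_on (R : realType) (n : nat) (M : manifold R n) (U : set M)
    (f : M -> R) : Prop :=
  forall c, @atlas R n M c ->
    Cinfty (cmap c @` (U `&` dom c)) (fun y => f (cinv c y)).

Definition smooth (R : realType) (n : nat) (M : manifold R n) (f : M -> R) :=
  smooth_on [set: M] f.

(* Tangent vectors at [p] are the derivations at [p] of the algebra of smooth
   functions, extended by the value 0 on functions that are not smooth, so that
   equality of tangent vectors is equality of functions. *)
Definition tvec (R : realType) (n : nat) (M : manifold R n) : Type :=
  (M -> R) -> R^o.

Definition tangent (R : realType) (n : nat) (M : manifold R n) (p : M)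
    (v : tvec M) : Prop :=
  [/\ (forall (a : R) f g, smooth f -> smooth g ->
         v (fun x => a * f x + g x) = a * v f + v g),
      (forall f g, smooth f -> smooth g ->
         v (fun x => f x * g x) = f p * v g + g p * v f)
    & (forall f, ~ smooth f -> v f = 0)].

Definition vfield (R : realType) (n : nat) (M : manifold R n) : Type :=
  M -> tvec M.

Definition vector_field (R : realType) (n : nat) (M : manifold R n)
    (X : vfield M) : Prop :=
  (forall p, tangent p (X p)) /\
  (forall f, smooth f -> smooth (fun p => X p f : R)).

Definition lie_bracket (R : realType) (n : nat) (M : manifold R n)
    (X Y : vfield M) : vfield M :=
  fun p f => X p (fun q => Y q f) - Y p (fun q => X q f).

Definition fmul (R : realType) (n : nat) (M : manifold R n) (f : M -> R)
    (X : vfield M) : vfield M := fun p => f p *: X p.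

Definition metric (R : realType) (n : nat) (M : manifold R n) : Type :=
  M -> tvec M -> tvec M -> R.

Definition riemannian (R : realType) (n : nat) (M : manifold R n)
    (g : metric M) : Prop :=
  [/\ (forall p v w, tangent p v -> tangent p w -> g p v w = g p w v),
      (forall p a u v w, tangent p u -> tangent p v -> tangent p w ->
         g p (a *: u + v) w = a * g p u w + g p v w),
      (forall p v, tangent p v -> v != 0 -> 0 < g p v v)
    & (forall X Y, vector_field X -> vector_field Y ->
         smooth (fun p => g p (X p) (Y p)))].

Definition smooth_curve (R : realType) (n : nat) (M : manifold R n)
    (c : R -> M) : Prop :=
  forall f, smooth f -> forall k t, derivable (derive1n k (f \o c)) t 1.

Definition velocity (R : realType) (n : nat) (M : manifold R n)
    (c : R -> M) (t : R) : tvec M :=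
  fun f => if `[< smooth f >] then derive1 (f \o c) t else 0.

Definition length (R : realType) (n : nat) (M : manifold R n) (g : metric M)
    (c : R -> M) : R :=
  (\int[@lebesgue_measure R]_(t in `[0, 1]%classic)
     Num.sqrt (g (c t) (velocity c t) (velocity c t)))%R.

(* Piecewise smooth curves can be reparametrized to smooth ones that stop at
   the corners, so smooth curves suffice. *)
Definition dist (R : realType) (n : nat) (M : manifold R n) (g : metric M)
    (p q : M) : R :=
  inf [set l | exists c : R -> M,
         [/\ smooth_curve c, c 0 = p, c 1 = q & l = length g c]].

Definition dball (R : realType) (n : nat) (M : manifold R n) (g : metric M)
    (p : M) (r : R) : set M := [set q | dist g p q < r].

Definition complete (R : realType) (n : nat) (M : manifold R n)
    (g : metric M) : Prop :=
  forall u : nat -> M,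
    (forall eps : R, 0 < eps -> exists N, forall i j,
       (N <= i)%N -> (N <= j)%N -> dist g (u i) (u j) < eps) ->
    exists x, forall eps : R, 0 < eps -> exists N, forall i,
      (N <= i)%N -> dist g x (u i) < eps.

(* [v'] is the image of [v], tangent at [q], under the differential of [phi],
   which need only be smooth near [q]; hence the extension [h] of [f \o phi]. *)
Definition pushes (R : realType) (n : nat) (M : manifold R n) (phi : M -> M)
    (q : M) (v v' : tvec M) : Prop :=
  tangent (phi q) v' /\
  forall f h : M -> R, smooth f -> smooth h ->
    (\forall x \near q, h x = f (phi x)) -> v' f = v h.

(* The inverse of such a [phi] is smooth by the inverse function theorem. *)
Definition isometry (R : realType) (n : nat) (M : manifold R n) (g : metric M)
    (U V : set M) (phi : M -> M) : Prop :=
  [/\ set_bij U V phi,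
      (forall f, smooth f -> smooth_on U (f \o phi))
    & (forall q v w v' w', U q -> tangent q v -> tangent q w ->
         pushes phi q v v' -> pushes phi q w w' ->
         g (phi q) v' w' = g q v w)].

Definition locally_homogeneous (R : realType) (n : nat) (M : manifold R n)
    (g : metric M) : Prop :=
  forall p q : M, exists r : R, 0 < r /\
    exists phi : M -> M,
      isometry g (dball g p r) (dball g q r) phi /\ phi p = q.

Definition unit_disk (R : realType) (n : nat) : set 'rV[R]_n :=
  [set x | \sum_(i < n) (x 0 i) ^+ 2 < 1].

Definition diffeomorphic_to_disk (R : realType) (n : nat) (M : manifold R n)
    : Prop :=
  exists (F : M -> 'rV[R]_n) (G : 'rV[R]_n -> M),
    [/\ (forall x, unit_disk (F x) /\ G (F x) = x),
        (forall y, unit_disk y -> F (G y) = y),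
        (forall i, smooth (fun x => F x 0 i))
      & (forall f : M -> R, smooth f -> Cinfty (@unit_disk R n) (f \o G))].

(* [nabla p v Y] is the covariant derivative of [Y] in the direction [v]. *)
Definition connection (R : realType) (n : nat) (M : manifold R n) : Type :=
  M -> tvec M -> vfield M -> tvec M.

Definition levi_civita (R : realType) (n : nat) (M : manifold R n)
    (g : metric M) (nabla : connection M) : Prop :=
  [/\ (forall p v Y, tangent p v -> vector_field Y -> tangent p (nabla p v Y))
      /\ (forall X Y, vector_field X -> vector_field Y ->
            vector_field (fun p => nabla p (X p) Y)),
      (forall p a v w Y, tangent p v -> tangent p w -> vector_field Y ->
         nabla p (a *: v + w) Y = a *: nabla p v Y + nabla p w Y),
      (forall p v Y Z, tangent p v -> vector_field Y -> vector_field Z ->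
         nabla p v (Y + Z) = nabla p v Y + nabla p v Z)
      /\ (forall p v f Y, tangent p v -> smooth f -> vector_field Y ->
            nabla p v (fmul f Y) = (v f : R) *: Y p + f p *: nabla p v Y),
      (forall p X Y, vector_field X -> vector_field Y ->
         nabla p (X p) Y - nabla p (Y p) X = lie_bracket X Y p)
    & (forall p v Y Z, tangent p v -> vector_field Y -> vector_field Z ->
         v (fun q => g q (Y q) (Z q))
         = g p (nabla p v Y) (Z p) + g p (Y p) (nabla p v Z))].

Definition curvature (R : realType) (n : nat) (M : manifold R n)
    (nabla : connection M) (X Y Z : vfield M) : vfield M :=
  fun p => nabla p (X p) (fun q => nabla q (Y q) Z)
         - nabla p (Y p) (fun q => nabla q (X q) Z)
         - nabla p (lie_bracket X Y p) Z.

Definition flat (R : realType) (n : nat) (M : manifold R n) (g : metric M)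
    : Prop :=
  forall nabla : connection M, levi_civita g nabla ->
    forall X Y Z, vector_field X -> vector_field Y -> vector_field Z ->
      curvature nabla X Y Z = 0.

Definition killing_field (R : realType) (n : nat) (M : manifold R n)
    (g : metric M) (X : vfield M) : Prop :=
  vector_field X /\
  forall Y Z, vector_field Y -> vector_field Z -> forall p,
    X p (fun q => g q (Y q) (Z q))
    = g p (lie_bracket X Y p) (Z p) + g p (Y p) (lie_bracket X Z p).

Definition lie_algebra_of_fields (R : realType) (n : nat) (M : manifold R n)
    (gg : set (vfield M)) : Prop :=
  [/\ gg 0, (forall (a : R) X Y, gg X -> gg Y -> gg (a *: X + Y))
    & (forall X Y, gg X -> gg Y -> gg (lie_bracket X Y))].

Definition spans_tangent_spaces (R : realType) (n : nat) (M : manifold R n)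
    (gg : set (vfield M)) : Prop :=
  forall p v, tangent p v -> exists2 X, gg X & X p = v.

(* The Lie group [G] is connected, so it acts by local isometries if and only
   if the generators of the action are Killing fields. *)
Definition G_invariant (R : realType) (n : nat) (M : manifold R n)
    (gg : set (vfield M)) (g : metric M) : Prop :=
  riemannian g /\ forall X, gg X -> killing_field g X.

Definition homogeneous_space (R : realType) (n : nat) (M : manifold R n)
    (g : metric M) (gg : set (vfield M)) : Prop :=
  [/\ connected [set: M],
      locally_homogeneous g,
      complete g \/ diffeomorphic_to_disk M,
      G_invariant gg g
    & lie_algebra_of_fields gg /\ spans_tangent_spaces gg].

Definition homogeneous_manifold (R : realType) (n : nat) (M : manifold R n)
    (gg : set (vfield M)) : Prop := exists g, homogeneous_space g gg.

Definition non_flat (R : realType) (n : nat) (M : manifold R n)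
    (gg : set (vfield M)) : Prop :=
  exists g, G_invariant gg g /\ ~ flat g.

Definition isotropy (R : realType) (n : nat) (M : manifold R n)
    (gg : set (vfield M)) (p : M) : set (vfield M) :=
  [set X | gg X /\ X p = 0].

(* Once an orthonormal basis of the Lie algebra is chosen, the latter becomes
   the space of columns with its standard scalar product, endomorphisms become
   matrices, the adjoint is the transpose, and [V(g)] becomes the space of
   alternating bilinear maps on columns. The basis is adapted to the canonical
   decomposition: the first [d] vectors span the isotropy subalgebra and the
   last [n] ones its complement. *)

Definition bracket (R : realType) (N : nat) : Type :=
  'cV[R]_N -> 'cV[R]_N -> 'cV[R]_N.

Definition inV (R : realType) (N : nat) (mu : bracket R N) : Prop :=
  (forall (a : R) X Y Z, mu (a *: X + Y) Z = a *: mu X Z + mu Y Z) /\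
  (forall X Y, mu X Y = - mu Y X).

Definition bvec (R : realType) (N : nat) (i : 'I_N) : 'cV[R]_N := delta_mx i 0.

Definition dotV (R : realType) (N : nat) (mu eta : bracket R N) : R :=
  \sum_(i < N) \sum_(j < N) \sum_(k < N)
    mu (bvec R i) (bvec R j) k 0 * eta (bvec R i) (bvec R j) k 0.

Definition dotM (R : realType) (N : nat) (A B : 'M[R]_N) : R :=
  \tr (A *m B^T).

Definition normM (R : realType) (N : nat) (A : 'M[R]_N) : R :=
  Num.sqrt (dotM A A).

Definition sym (R : realType) (N : nat) (A : 'M[R]_N) : Prop := A^T = A.

Definition act (R : realType) (N : nat) (h : 'M[R]_N) (mu : bracket R N)
    : bracket R N :=
  fun X Y => h *m mu (invmx h *m X) (invmx h *m Y).

Definition pi_act (R : realType) (N : nat) (A : 'M[R]_N) (mu : bracket R N)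
    : bracket R N :=
  fun X Y => A *m mu X Y - mu (A *m X) Y - mu X (A *m Y).

Definition ad_mx (R : realType) (N : nat) (mu : bracket R N) (X : 'cV[R]_N)
    : 'M[R]_N := \matrix_(i, j) mu X (bvec R j) i 0.

Definition killing_form (R : realType) (N : nat) (mu : bracket R N)
    (X Y : 'cV[R]_N) : R := \tr (ad_mx mu X *m ad_mx mu Y).

(* Entries obtained by pairing with the symmetrized elementary matrices; see
   [momentP]. *)
Definition moment (R : realType) (N : nat) (mu : bracket R N) : 'M[R]_N :=
  \matrix_(i, j) ((dotV mu mu)^-1 *
    dotV (pi_act (2^-1 *: (delta_mx i j + delta_mx j i)) mu) mu).

Lemma dotV_pi_act_linear (R : realType) (N : nat) (mu : bracket R N) :
  inV mu -> forall (a : R) A B,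
  dotV (pi_act (a *: A + B) mu) mu
  = a * dotV (pi_act A mu) mu + dotV (pi_act B mu) mu.
Proof.
case=> lin alt a A B.
have linr b X Y Z : mu X (b *: Y + Z) = b *: mu X Y + mu X Z.
  by rewrite alt lin opprD -scalerN -!alt.
rewrite /dotV mulr_sumr -big_split; apply: eq_bigr => i _ /=.
rewrite mulr_sumr -big_split; apply: eq_bigr => j _ /=.
rewrite mulr_sumr -big_split; apply: eq_bigr => k _ /=.
rewrite /pi_act !mulmxDl -!scalemxAl lin linr !mxE; ring.
Qed.

Lemma moment_sym (R : realType) (N : nat) (mu : bracket R N) :
  sym (moment mu).
Proof. by apply/matrixP => i j; rewrite !mxE [delta_mx j i + _]addrC. Qed.

Lemma momentP (R : realType) (N : nat) (mu : bracket R N) :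
  inV mu -> forall A, sym A ->
  dotM (moment mu) A = (dotV mu mu)^-1 * dotV (pi_act A mu) mu.
Proof.
move=> Vmu A symA; pose L B := dotV (pi_act B mu) mu.
have LD B C : L (B + C) = L B + L C.
  by rewrite -[B]scale1r /L dotV_pi_act_linear // mul1r scale1r.
have L0 : L 0 = 0 by apply: (addrI (L 0)); rewrite -LD !addr0.
have LZ a B : L (a *: B) = a * L B.
  by rewrite -[a *: B]addr0 /L dotV_pi_act_linear // -/(L 0) L0 addr0.
have Lsum I (r : seq I) F : L (\sum_(i <- r) F i) = \sum_(i <- r) L (F i).
  exact: (big_morph L LD L0).
have LA : L A = \sum_i \sum_j A i j * L (delta_mx i j).
  rewrite {1}[A]matrix_sum_delta Lsum; apply: eq_bigr => i _.
  by rewrite Lsum; apply: eq_bigr => j _; rewrite LZ.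
have LA' : L A = \sum_i \sum_j A i j * L (delta_mx j i).
  rewrite LA exchange_big /=; apply: eq_bigr => i _; apply: eq_bigr => j _.
  by rewrite -{1}symA mxE.
have -> : dotV (pi_act A mu) mu = 2^-1 * (L A + L A).
  by rewrite -/(L A); field.
rewrite {1}LA LA' -big_split mulrA mulr_sumr; apply: eq_bigr => i _.
rewrite mxE -big_split mulr_sumr; apply: eq_bigr => j _ /=.
by rewrite !mxE -/(L _) LZ LD; ring.
Qed.

Definition energy (R : realType) (N : nat) (mu : bracket R N) : R :=
  dotM (moment mu) (moment mu).

Definition is_gradient (R : realType) (N : nat) (mu G : bracket R N) : Prop :=
  inV G /\ forall v, inV v ->
    is_derive (0 : R) 1 (fun s : R => energy (mu + s *: v)) (dotV G v).

Definition critical (R : realType) (N : nat) (mu : bracket R N) : Prop :=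
  [/\ inV mu, mu != 0 & is_gradient mu 0].

Definition neg_gradient_flow (R : realType) (N : nat) (c : R -> bracket R N)
    : Prop :=
  forall t, 0 <= t -> inV (c t) /\ c t != 0 /\
    exists G, is_gradient (c t) G /\
      forall X Y k, is_derive t 1 (fun s => c s X Y k 0) (- G X Y k 0).

Definition flow_converges (R : realType) (N : nat) (c : R -> bracket R N)
    (lam : bracket R N) : Prop :=
  forall X Y k, c t X Y k 0 @[t --> +oo] --> lam X Y k 0.

Definition orthogonal_mx (R : realType) (N : nat) (k : 'M[R]_N) : Prop :=
  k *m k^T = 1%:M.

Definition stratum (R : realType) (N : nat) (beta : 'M[R]_N)
    : set (bracket R N) :=
  [set mu | inV mu /\ mu != 0 /\
     exists (c : R -> bracket R N) (lam : bracket R N),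
       [/\ c 0 = mu, neg_gradient_flow c, flow_converges c lam, critical lam
         & exists2 k, orthogonal_mx k & moment lam = k *m beta *m invmx k]].

Definition beta_plus (R : realType) (N : nat) (beta : 'M[R]_N) : 'M[R]_N :=
  beta + (dotM beta beta)%:M.

Definition Vge0 (R : realType) (N : nat) (A : 'M[R]_N) : set (bracket R N) :=
  [set mu | exists (r : nat) (lam : 'I_r -> R) (nu : 'I_r -> bracket R N),
     (forall i, [/\ inV (nu i), 0 <= lam i & pi_act A (nu i) = lam i *: nu i])
     /\ mu = \sum_(i < r) nu i].

Section ModifiedRicci.
Variables (R : realType) (d n : nat).
Implicit Type mu : bracket R (d + n).

Definition m_vec (i : 'I_n) : 'cV[R]_(d + n) := bvec R (rshift d i).

Definition mu_m mu (i j k : 'I_n) : R :=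
  dsubmx (mu (m_vec i) (m_vec j)) k 0.

(* Polarization of the quadratic form; see [M_muP]. *)
Definition M_mu mu : 'M[R]_n :=
  \matrix_(a, b)
    (- 2^-1 * (\sum_(i < n) \sum_(j < n) mu_m mu a i j * mu_m mu b i j)
     + 4^-1 * (\sum_(i < n) \sum_(j < n) mu_m mu i j a * mu_m mu i j b)).

Lemma M_muP mu (x : 'cV[R]_n) : inV mu ->
  let X : 'cV[R]_(d + n) := col_mx 0 x in
  (x^T *m M_mu mu *m x) 0 0
  = - 2^-1 * (\sum_(i < n) \sum_(j < n)
                 (dsubmx (mu X (m_vec i)) j 0) ^+ 2)
    + 4^-1 * (\sum_(i < n) \sum_(j < n)
                 (\sum_(k < n) mu_m mu i j k * x k 0) ^+ 2).
Proof.
case=> lin _ X; pose T (i j k : 'I_n) := mu_m mu k i j * x k 0.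
have lin0 Z : mu 0 Z = 0.
  apply: (addrI (mu 0 Z)); rewrite -{1}[mu 0 Z]scale1r -lin.
  by rewrite scale1r !addr0.
have linZ c Y Z : mu (c *: Y) Z = c *: mu Y Z.
  by rewrite -[c *: Y]addr0 lin lin0 addr0.
have linD Y Y' Z : mu (Y + Y') Z = mu Y Z + mu Y' Z.
  by rewrite -[Y]scale1r lin !scale1r.
have -> : X = \sum_k x k 0 *: m_vec k.
  rewrite [LHS](matrix_sum_delta _); rewrite big_split_ord /= big1 ?add0r.
    apply: eq_bigr => k _; rewrite big_ord1.
    by rewrite /X col_mxEd.
  by move=> k _; rewrite big_ord1 /X col_mxEu mxE scale0r.
have E i j : dsubmx (mu (\sum_k x k 0 *: m_vec k) (m_vec i)) j 0
    = \sum_k T i j k.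
  rewrite (big_morph (fun Y => mu Y (m_vec i)) (fun Y Z => linD Y Z _) (lin0 _)).
  rewrite mxE summxE; apply: eq_bigr => k _.
  by rewrite linZ mxE /T /mu_m mxE mulrC.
have sq (F : 'I_n -> R) :
    (\sum_k F k) ^+ 2 = \sum_a \sum_b F b * F a.
  rewrite expr2 mulr_sumr; apply: eq_bigr => a _.
  by rewrite mulr_suml.
have swap (F : 'I_n -> 'I_n -> 'I_n -> R) :
    \sum_i \sum_j (\sum_k F i j k) ^+ 2
    = \sum_a \sum_b \sum_i \sum_j F i j b * F i j a.
  under eq_bigr => i _ do under eq_bigr => j _ do rewrite sq.
  under eq_bigr => i _.
    rewrite exchange_big /=; under eq_bigr => a _ do rewrite exchange_big /=.
    over.
  rewrite exchange_big /=; apply: eq_bigr => a _.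
  by rewrite exchange_big.
under [in RHS]eq_bigr => i _ do under eq_bigr => j _ do rewrite E.
rewrite !swap mxE !mulr_sumr -big_split; apply: eq_bigr => a _ /=.
rewrite mxE mulr_suml !mulr_sumr -big_split; apply: eq_bigr => b _ /=.
have pull (G H : 'I_n -> 'I_n -> R) c : (forall i j, H i j = G i j * c) ->
    \sum_i \sum_j H i j = (\sum_i \sum_j G i j) * c.
  move=> GH; rewrite mulr_suml; apply: eq_bigr => i _.
  by rewrite mulr_suml; apply: eq_bigr => j _.
rewrite !mxE.
rewrite (pull (fun i j => mu_m mu b i j * mu_m mu a i j)
  (fun i j => T i j b * T i j a) (x b 0 * x a 0)); last first.
  by move=> i j; rewrite /T; ring.
rewrite (pull (fun i j => mu_m mu i j b * mu_m mu i j a)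
  (fun i j => mu_m mu i j b * x b 0 * (mu_m mu i j a * x a 0))
  (x b 0 * x a 0)); last by move=> i j; ring.
ring.
Qed.

Definition B_mu mu : 'M[R]_n :=
  \matrix_(a, b) killing_form mu (m_vec a) (m_vec b).

Definition Ric_star mu : 'M[R]_n := M_mu mu - 2^-1 *: B_mu mu.

Definition scal_star mu : R := \tr (Ric_star mu).

(* [drsubmx beta] is the matrix of [beta] restricted to [m] (which [beta]
   preserves, for the [beta] considered). *)
Definition beta_m (beta : 'M[R]_(d + n)) : 'M[R]_n :=
  (- \tr (drsubmx beta))^-1 *: drsubmx beta.

Definition extend_id (g : 'M[R]_n) : 'M[R]_(d + n) := block_mx 1%:M 0 0 g.

End ModifiedRicci.

Definition lincomb (R : realType) (n : nat) (M : manifold R n) (N : nat)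
    (e : 'I_N -> vfield M) (x : 'cV[R]_N) : vfield M :=
  \sum_(i < N) x i 0 *: e i.

Definition is_basis (R : realType) (n : nat) (M : manifold R n) (N : nat)
    (S : set (vfield M)) (e : 'I_N -> vfield M) : Prop :=
  injective (lincomb e) /\ S = range (lincomb e).

Definition represents (R : realType) (n : nat) (M : manifold R n) (N : nat)
    (e : 'I_N -> vfield M) (mug : bracket R N) : Prop :=
  forall x y, lincomb e (mug x y) = lie_bracket (lincomb e x) (lincomb e y).

(* The complement of the isotropy algebra that is orthogonal to it for the
   Killing form. *)
Definition canonical_complement (R : realType) (n : nat) (M : manifold R n)
    (N : nat) (gg : set (vfield M)) (p : M) (e : 'I_N -> vfield M)
    (mug : bracket R N) : set (vfield M) :=
  [set X | exists2 x, X = lincomb e x &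
     forall z, isotropy gg p (lincomb e z) -> killing_form mug x z = 0].

(* The trace over the tangent space at [p] is computed in the basis [E i p],
   which is assumed orthonormal. *)
Definition isotropy_dot (R : realType) (n : nat) (M : manifold R n)
    (gbar : metric M) (nabla : connection M) (p : M) (E : 'I_n -> vfield M)
    (Z1 Z2 : vfield M) : R :=
  - \sum_(i < n) gbar p (nabla p (nabla p (E i p) Z2) Z1) (E i p).

(* [e] is an orthonormal basis of the Lie algebra, for the scalar product
   induced by [gbar], adapted to the canonical decomposition. The isotropy
   algebra and its complement are orthogonal by definition of the scalar
   product, so there is no condition relating the two parts of the basis. *)
Definition adapted_orthonormal_basis (R : realType) (n d : nat)
    (M : manifold R n) (gg : set (vfield M)) (p : M) (gbar : metric M)
    (nabla : connection M) (e : 'I_(d + n) -> vfield M)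
    (mug : bracket R (d + n)) : Prop :=
  let F (a : 'I_d) := e (lshift n a) in
  let E (i : 'I_n) := e (rshift d i) in
  [/\ is_basis gg e,
      is_basis (isotropy gg p) F,
      is_basis (canonical_complement gg p e mug) E,
      (forall i j, gbar p (E i p) (E j p) = (i == j)%:R)
    & (forall a b, isotropy_dot gbar nabla p E (F a) (F b) = (a == b)%:R)].

Definition global_flow (R : realType) (n : nat) (M : manifold R n)
    (X : vfield M) (Phi : R -> M -> M) : Prop :=
  forall q, Phi 0 q = q /\
    forall (t : R) (f : M -> R), smooth f ->
      is_derive t 1 (fun s : R => f (Phi s q)) (X (Phi t q) f : R).

(* The transformations of [M] by which [G] acts, when the action is global:
   [G] is generated by its one-parameter subgroups. *)
Inductive G_acts_by (R : realType) (n : nat) (M : manifold R n)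
    (gg : set (vfield M)) : (M -> M) -> Prop :=
| G_acts_id : G_acts_by gg id
| G_acts_flow (X : vfield M) (Phi : R -> M -> M) (t : R) (phi : M -> M) :
    gg X -> global_flow X Phi -> G_acts_by gg phi ->
    G_acts_by gg (Phi t \o phi).

Definition globally_homogeneous (R : realType) (n : nat) (M : manifold R n)
    (gg : set (vfield M)) : Prop :=
  (forall X, gg X -> exists Phi, global_flow X Phi) /\
  (forall p q : M, exists2 phi, G_acts_by gg phi & phi p = q).

(* [A] is the matrix of the push-forward of fields by [phi], which is the
   adjoint action of an element of [G] acting as [phi]. *)
Definition is_Ad (R : realType) (n N : nat) (M : manifold R n)
    (e : 'I_N -> vfield M) (phi : M -> M) (A : 'M[R]_N) : Prop :=
  forall x q (f : M -> R), smooth f ->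
    lincomb e (A *m x) (phi q) f = lincomb e x q (f \o phi).

Definition is_exp (R : realType) (N : nat) (B A : 'M[R]_N) : Prop :=
  forall i j,
    series (fun k : nat => (k`!%:R)^-1 * (B ^+ k) i j) @ \oo --> A i j.

Inductive Ad_H0 (R : realType) (n N : nat) (M : manifold R n)
    (gg : set (vfield M)) (p : M) (e : 'I_N -> vfield M) (mug : bracket R N)
    : 'M[R]_N -> Prop :=
| Ad_H0_1 : Ad_H0 gg p e mug 1%:M
| Ad_H0_exp (z : 'cV[R]_N) (B A : 'M[R]_N) :
    isotropy gg p (lincomb e z) -> is_exp (ad_mx mug z) B ->
    Ad_H0 gg p e mug A -> Ad_H0 gg p e mug (B *m A).

(* [Ad(H)]: in general [H] is the connected subgroup [H0] with Lie algebra the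
   isotropy algebra; in the globally homogeneous case [H] is the isotropy
   subgroup of [G] (which contains [H0], and so the union is [Ad(H)]). *)
Definition Ad_H (R : realType) (n N : nat) (M : manifold R n)
    (gg : set (vfield M)) (p : M) (e : 'I_N -> vfield M) (mug : bracket R N)
    : set 'M[R]_N :=
  [set A | Ad_H0 gg p e mug A \/
     (globally_homogeneous gg /\
      exists phi, [/\ G_acts_by gg phi, phi p = p & is_Ad e phi A])].

Definition GL_H (R : realType) (n d : nat) (M : manifold R n)
    (gg : set (vfield M)) (p : M) (e : 'I_(d + n) -> vfield M)
    (mug : bracket R (d + n)) : set 'M[R]_n :=
  [set h | h \in unitmx /\
     forall A, Ad_H gg p e mug A -> h *m drsubmx A = drsubmx A *m h].

Definition orbit_H (R : realType) (n d : nat) (M : manifold R n)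
    (gg : set (vfield M)) (p : M) (e : 'I_(d + n) -> vfield M)
    (mug : bracket R (d + n)) : set (bracket R (d + n)) :=
  [set mu | exists2 h, GL_H gg p e mug h & mu = act (extend_id d h) mug].

(* Main.v *)
(* Write [S = beta_plus beta].

   The bracket [mug] satisfies the Jacobi identity; since the gradient of the
   energy at [nu] is a multiple of [pi(beta_plus (m(nu))) nu], the Jacobiator
   solves a linear differential equation along the gradient flow, and so the
   limit [lam] of the flow of [mug] is a Lie bracket too. As [lam] is critical,
   [beta_plus (m(lam))], which is conjugate to [S], is a derivation of [lam];
   pairing [m(lam)] with [[ad x, (ad x)^T]], for [x] an eigenvector, shows that
   its eigenvalues are nonnegative.

   Consequently, for a bracket in [V^{>=0}_S], the operator [ad x] is nilpotent
   on the filtration by the eigenvalues of [S] when [x] lies in the image of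
   [S], and this image lies in the radical of the Killing form. Applied to
   [mug], this puts the image of [S] in [m], the Killing complement of [h]; as
   [S] is symmetric, it vanishes on [h]. Applied to [mu], it gives
   [<B_mu, S|m> = 0], while [4 <M_mu, S|m> = <pi(S|m) mu_m, mu_m> >= 0]. Hence
   [<Ric*, S|m> >= 0], that is,
   [<Ric*, beta|m> >= - |beta|^2 scal*].

   Finally [S|h = 0] and [tr beta = -1] yield
   [|beta|m|^2 = - |beta|^2 tr beta|m], so that
   [<Ric*, beta_m> >= |scal*| |beta_m|^2], and the theorem follows by expanding
   [|Ric* - |scal*| beta_m|^2 >= 0]. *)

Require Import Defs.
From HB Require Import structures.
From mathcomp Require Import all_boot all_order all_algebra.
From mathcomp Require Import all_classical all_reals all_analysis.
From mathcomp Require Import complex ring lra.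

Set Implicit Arguments.
Unset Strict Implicit.
Unset Printing Implicit Defensive.

Import Order.TTheory GRing.Theory Num.Theory.
Import numFieldNormedType.Exports.
Local Open Scope classical_set_scope.
Local Open Scope ring_scope.

(** * Structure constants *)

(* Derivatives along the gradient flow [c] are taken on arrays of structure
   constants: the flow equation gives two-sided derivatives at [0], but [c t]
   is only known to be bilinear for [0 <= t]. *)
Section Arrays.
Variables (R : realType) (p : nat).
Implicit Types (T U : 'I_p -> 'I_p -> 'I_p -> R) (A : 'M[R]_p).

Definition arr_dot T U : R := \sum_i \sum_j \sum_k T i j k * U i j k.

(** The action [pi] in coordinates: [i] and [j] index the two arguments, [k] the value, and [l] is
    contracted with [A]. *)
Definition arr_pi A T (i j k : 'I_p) : R :=
  \sum_l A k l * T i j l - \sum_l A l i * T l j k - \sum_l A l j * T i l k.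

Lemma arr_dotC T U : arr_dot T U = arr_dot U T.
Proof.
by do 3!(apply: eq_bigr => ? _); rewrite mulrC.
Qed.

Lemma arr_dotDl a T T' U :
  arr_dot (fun i j k => a * T i j k + T' i j k) U
  = a * arr_dot T U + arr_dot T' U.
Proof.
rewrite /arr_dot mulr_sumr -big_split; apply: eq_bigr => i _ /=.
rewrite mulr_sumr -big_split; apply: eq_bigr => j _ /=.
rewrite mulr_sumr -big_split; apply: eq_bigr => k _ /=; ring.
Qed.

Lemma arr_dot_ge0 T : 0 <= arr_dot T T.
Proof. by do 3!(apply: sumr_ge0 => ? _); exact: sqr_ge0. Qed.

Lemma arr_dot_eq0 T : arr_dot T T = 0 -> forall i j k, T i j k = 0.
Proof.
move=> /psumr_eq0P H i j k.
have {H} : \sum_j \sum_k T i j k * T i j k = 0.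
  by apply: H => // l _; do 2!(apply: sumr_ge0 => ? _); exact: sqr_ge0.
move/psumr_eq0P => H.
have {H} : \sum_k T i j k * T i j k = 0.
  by apply: H => // l _; apply: sumr_ge0 => ? _; exact: sqr_ge0.
move/psumr_eq0P => H.
have /eqP : T i j k * T i j k = 0 by apply: H => // l _; exact: sqr_ge0.
by rewrite mulf_eq0 orbb => /eqP.
Qed.

(** In the three quadruple sums of the expansion, swapping the names of [l] and of [k], [i] or [j]
    moves [A], transposed, to the other factor. *)
Lemma arr_pi_adjoint A T U :
  arr_dot (arr_pi A T) U = arr_dot T (arr_pi A^T U).
Proof.
pose a i j k l := A k l * T i j l * U i j k.
pose b i j k l := A l i * T l j k * U i j k.
pose c i j k l := A l j * T i l k * U i j k.
transitivity (\sum_i \sum_j \sum_k \sum_l a i j k l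
  - \sum_i \sum_j \sum_k \sum_l b i j k l
  - \sum_i \sum_j \sum_k \sum_l c i j k l).
  rewrite -!sumrB; apply: eq_bigr => i _.
  rewrite -!sumrB; apply: eq_bigr => j _.
  rewrite -!sumrB; apply: eq_bigr => k _.
  by rewrite /arr_pi !mulrBl !mulr_suml.
transitivity (\sum_i \sum_j \sum_k \sum_l a i j l k
  - \sum_i \sum_j \sum_k \sum_l b l j k i
  - \sum_i \sum_j \sum_k \sum_l c i l k j).
  congr (_ - _ - _).
  - by do 2!(apply: eq_bigr => ? _); rewrite exchange_big.
  - rewrite exchange_big /= [RHS]exchange_big; apply: eq_bigr => j _ /=.
    rewrite exchange_big /= [RHS]exchange_big; apply: eq_bigr => k _ /=.
    by rewrite exchange_big.
  - apply: eq_bigr => i _.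
    rewrite exchange_big /= [RHS]exchange_big; apply: eq_bigr => k _ /=.
    by rewrite exchange_big.
rewrite -!sumrB; apply: eq_bigr => i _.
rewrite -!sumrB; apply: eq_bigr => j _.
rewrite -!sumrB; apply: eq_bigr => k _.
rewrite /arr_pi !mulrBr !mulr_sumr.
by congr (_ - _ - _); apply: eq_bigr => l _; rewrite /a /b /c !mxE; ring.
Qed.

End Arrays.

Section Brackets.
Variables (R : realType) (N : nat).
Implicit Types (mu nu : bracket R N) (A B : 'M[R]_N) (X Y Z : 'cV[R]_N).

Definition coef mu (i j k : 'I_N) : R := mu (bvec R i) (bvec R j) k 0.

Lemma dotVE mu nu : dotV mu nu = arr_dot (coef mu) (coef nu).
Proof. by []. Qed.

Lemma cV_bvec X : X = \sum_i X i 0 *: bvec R i.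
Proof.
rewrite [LHS](matrix_sum_delta _); apply: eq_bigr => i _.
by rewrite big_ord1.
Qed.

Lemma mul_bvec A i : A *m bvec R i = \sum_l A l i *: bvec R l.
Proof.
rewrite [LHS]cV_bvec; apply: eq_bigr => l _; congr (_ *: _).
rewrite mxE (bigD1 i) //= big1 ?addr0 ?mxE ?eqxx ?mulr1 //.
by move=> j /negPf ji; rewrite mxE ji mulr0.
Qed.

Section Bilinear.
Variable mu : bracket R N.
Hypothesis Vmu : inV mu.

Lemma inVC X Y : mu X Y = - mu Y X. Proof. exact: Vmu.2. Qed.

Lemma inV0l Y : mu 0 Y = 0.
Proof.
apply: (addrI (mu 0 Y)); rewrite -{1}[mu 0 Y]scale1r -Vmu.1.
by rewrite scale1r !addr0.
Qed.

Lemma inV0r X : mu X 0 = 0. Proof. by rewrite inVC inV0l oppr0. Qed.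

Lemma inVDl X Y Z : mu (X + Y) Z = mu X Z + mu Y Z.
Proof. by rewrite -[X]scale1r Vmu.1 !scale1r. Qed.

Lemma inVDr X Y Z : mu X (Y + Z) = mu X Y + mu X Z.
Proof. by rewrite inVC inVDl opprD -!inVC. Qed.

Lemma inVZl a X Y : mu (a *: X) Y = a *: mu X Y.
Proof. by rewrite -[a *: X]addr0 Vmu.1 inV0l addr0. Qed.

Lemma inVZr a X Y : mu X (a *: Y) = a *: mu X Y.
Proof. by rewrite inVC inVZl -scalerN -inVC. Qed.

Lemma inVBl X Y Z : mu (X - Y) Z = mu X Z - mu Y Z.
Proof. by rewrite inVDl -scaleN1r inVZl scaleN1r. Qed.

Lemma inVBr X Y Z : mu X (Y - Z) = mu X Y - mu X Z.
Proof. by rewrite inVDr -scaleN1r inVZr scaleN1r. Qed.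

Lemma inV_suml I (r : seq I) F Y :
  mu (\sum_(i <- r) F i) Y = \sum_(i <- r) mu (F i) Y.
Proof. exact: (big_morph (mu^~ Y) (fun X Z => inVDl X Z Y) (inV0l Y)). Qed.

Lemma inV_sumr I (r : seq I) F X :
  mu X (\sum_(i <- r) F i) = \sum_(i <- r) mu X (F i).
Proof. exact: (big_morph (mu X) (fun Y Z => inVDr X Y Z) (inV0r X)). Qed.

Lemma coef_pi_act A i j k : coef (pi_act A mu) i j k = arr_pi A (coef mu) i j k.
Proof.
rewrite /coef /pi_act !mul_bvec inV_suml inV_sumr !mxE !summxE.
by congr (_ - _ - _); apply: eq_bigr => l _; rewrite ?inVZl ?inVZr mxE.
Qed.

Lemma inV_coef X Y k :
  mu X Y k 0 = \sum_i \sum_j X i 0 * Y j 0 * coef mu i j k.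
Proof.
rewrite {1}[X]cV_bvec inV_suml summxE; apply: eq_bigr => i _.
rewrite {1}[Y]cV_bvec inV_sumr summxE; apply: eq_bigr => j _.
by rewrite inVZl inVZr !mxE mulrA.
Qed.

Lemma inV_coef_eq0 : (forall i j k, coef mu i j k = 0) -> mu = 0.
Proof.
move=> mu0; apply/funext => X; apply/funext => Y; apply/matrixP => k j.
rewrite ord1 inV_coef mxE big1 // => i _; rewrite big1 // => l _.
by rewrite mu0 mulr0.
Qed.

Lemma dotV_eq0 : dotV mu mu = 0 -> mu = 0.
Proof. by rewrite dotVE => /arr_dot_eq0; exact: inV_coef_eq0. Qed.

Lemma dotV_gt0 : mu != 0 -> 0 < dotV mu mu.
Proof.
move=> mu0; rewrite lt_neqAle arr_dot_ge0 andbT eq_sym.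
by apply: contra mu0 => /eqP/dotV_eq0 ->.
Qed.

Lemma ad_mxE X Y : ad_mx mu X *m Y = mu X Y.
Proof.
rewrite [in RHS](cV_bvec Y) inV_sumr; apply/matrixP => i j.
rewrite ord1 mxE summxE; apply: eq_bigr => l _.
by rewrite inVZr !mxE mulrC.
Qed.

Lemma inV_pi_act A : inV (pi_act A mu).
Proof.
split=> [a X Y Z|X Y]; rewrite /pi_act.
  rewrite mulmxDr -scalemxAr !Vmu.1 mulmxDr -scalemxAr.
  by apply/matrixP => i j; rewrite !mxE; ring.
rewrite inVC mulmxN [mu (A *m X) Y]inVC [mu X _]inVC.
by apply/matrixP => i j; rewrite !mxE; ring.
Qed.

End Bilinear.

End Brackets.

(** * The trace scalar product on matrices *)

Section MatrixInner.
Variables (R : realType) (N : nat).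
Implicit Types (A B C : 'M[R]_N).

Lemma dotME A B : dotM A B = \sum_i \sum_j A i j * B i j.
Proof.
apply: eq_bigr => i _; rewrite mxE; apply: eq_bigr => j _.
by rewrite mxE.
Qed.

Lemma dotMC A B : dotM A B = dotM B A.
Proof. by rewrite !dotME; do 2!(apply: eq_bigr => ? _); rewrite mulrC. Qed.

Lemma dotMDl A B C : dotM (A + B) C = dotM A C + dotM B C.
Proof. by rewrite /dotM mulmxDl mxtraceD. Qed.

Lemma dotMZl a A B : dotM (a *: A) B = a * dotM A B.
Proof. by rewrite /dotM -scalemxAl mxtraceZ. Qed.

Lemma dotMZr a A B : dotM A (a *: B) = a * dotM A B.
Proof. by rewrite dotMC dotMZl dotMC. Qed.

Lemma dotM_sqrB a A B : dotM (A - a *: B) (A - a *: B)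
  = dotM A A - 2 * a * dotM A B + a ^+ 2 * dotM B B.
Proof.
rewrite -scaleNr dotMDl dotMZl !(dotMC _ (A + _)) !dotMDl !dotMZl (dotMC B A).
by ring.
Qed.

Lemma dotM_scalar a B : dotM a%:M B = a * \tr B.
Proof. by rewrite /dotM mul_scalar_mx mxtraceZ mxtrace_tr. Qed.

Lemma dotM_ge0 A : 0 <= dotM A A.
Proof. by rewrite dotME; do 2!(apply: sumr_ge0 => ? _); exact: sqr_ge0. Qed.

Lemma dotM_eq0 A : dotM A A = 0 -> A = 0.
Proof.
rewrite dotME => /psumr_eq0P H; apply/matrixP => i j; rewrite mxE.
have {H} : \sum_j A i j * A i j = 0.
  by apply: H => // l _; apply: sumr_ge0 => ? _; exact: sqr_ge0.
move/psumr_eq0P => H.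
have /eqP : A i j * A i j = 0 by apply: H => // l _; exact: sqr_ge0.
by rewrite mulf_eq0 orbb => /eqP.
Qed.

Lemma eq_mulmx_cV A B : (forall X : 'cV[R]_N, A *m X = B *m X) -> A = B.
Proof.
move=> AB; apply/matrixP => i j; have /matrixP/(_ i 0) := AB (bvec R j).
by rewrite -!colE !mxE.
Qed.

End MatrixInner.

(** * Derivations of a Lie bracket and its moment map *)

Definition jacobi (R : realType) (N : nat) (mu : bracket R N) :=
  forall X Y Z, mu X (mu Y Z) = mu (mu X Y) Z + mu Y (mu X Z).

Section Derivations.
Variables (R : realType) (N : nat).
Implicit Types (mu nu : bracket R N) (A B : 'M[R]_N) (X Y Z : 'cV[R]_N).

Lemma pi_act_adjoint mu nu A : inV mu -> inV nu ->
  dotV (pi_act A mu) nu = dotV mu (pi_act A^T nu).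
Proof.
move=> Vmu Vnu; rewrite !dotVE.
have E (eta : bracket R N) B : inV eta ->
    coef (pi_act B eta) = arr_pi B (coef eta).
  by move=> ?; do 3!apply/funext => ?; exact: coef_pi_act.
by rewrite !E // arr_pi_adjoint.
Qed.

Lemma dotV_ge0 mu : 0 <= dotV mu mu. Proof. exact: arr_dot_ge0. Qed.

Lemma dotVDl a mu mu' nu :
  dotV (a *: mu + mu') nu = a * dotV mu nu + dotV mu' nu.
Proof.
rewrite !dotVE -arr_dotDl; congr arr_dot.
by do 3!apply/funext => ?; rewrite /coef !mxE.
Qed.

Lemma dotV0l nu : dotV 0 nu = 0.
Proof.
rewrite dotVE; do 3!(rewrite /arr_dot big1 // => ? _).
by rewrite /coef mxE mul0r.
Qed.

Lemma dotVZl a mu nu : dotV (a *: mu) nu = a * dotV mu nu.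
Proof. by rewrite -[a *: mu]addr0 dotVDl dotV0l addr0. Qed.

Lemma pi_act_commutator mu A B : inV mu ->
  pi_act (A *m B - B *m A) mu = pi_act A (pi_act B mu) - pi_act B (pi_act A mu).
Proof.
move=> Vmu; apply/funext => X; apply/funext => Y.
rewrite !fctE /pi_act.
rewrite !mulmxBl !mulmxBr -!mulmxA (inVBl Vmu) (inVBr Vmu).
by apply/matrixP => i j; rewrite !mxE; ring.
Qed.

(** [pi_act A mu = 0] says that [A] is a derivation of [mu]; [jacobi] is the Jacobi identity written
    as this property of ad X. *)
Lemma pi_act_ad mu X : inV mu -> jacobi mu -> pi_act (ad_mx mu X) mu = 0.
Proof.
move=> Vmu J; apply/funext => Y; apply/funext => Z.
by rewrite /pi_act !ad_mxE // J addrAC addrK subrr.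
Qed.

(* With [A := ad x], [<m(mu), [A, A^T]>] equals both [c |A|^2] and
   [|pi(A^T) mu|^2 / |mu|^2]. If [A = 0], then [x] is central and [x x^T] is
   used instead of [[A, A^T]]. *)
Lemma derivation_eigenvalue_ge0 mu (x : 'cV[R]_N) (c : R) :
  inV mu -> mu != 0 -> jacobi mu ->
  pi_act (beta_plus (moment mu)) mu = 0 ->
  x != 0 -> beta_plus (moment mu) *m x = c *: x -> 0 <= c.
Proof.
move=> Vmu mu0 J; set m := moment mu; set S := beta_plus m => D x0 Sx.
have nrm_gt0 := dotV_gt0 Vmu mu0.
pose A := ad_mx mu x.
(* [S] is a derivation of [mu], so that [S, ad x] = ad (S x) = c ad x. *)
have SA : S *m A - A *m S = c *: A.
  apply: eq_mulmx_cV => Y; rewrite mulmxBl -!mulmxA -scalemxAl !ad_mxE //.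
  rewrite -inVZl // -Sx; move/(congr1 (fun f => f x Y)): D.
  by rewrite /pi_act => /eqP; rewrite subr_eq0 subr_eq addrC -subr_eq => /eqP.
have [A0|A0] := eqVneq A 0.
  have mux Y : mu x Y = 0 by rewrite -ad_mxE // -/A A0 mul0mx.
  have xx_gt0 : 0 < (x^T *m x) 0 0.
    rewrite mxE lt_neqAle; apply/andP; split; last first.
      by apply: sumr_ge0 => i _; rewrite mxE; exact: sqr_ge0.
    rewrite eq_sym; apply: contra x0 => /eqP/psumr_eq0P H.
    apply/eqP/matrixP => i j; rewrite ord1 [RHS]mxE.
    have /eqP : x^T 0 i * x i 0 = 0.
      by apply: H => // k _; rewrite mxE; exact: sqr_ge0.
    by rewrite mxE mulf_eq0 orbb => /eqP.
  have symxx : sym (x *m x^T) by rewrite /sym trmx_mul trmxK.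
  (* Since [x] is central, the two terms in which [x *m x^T] acts on an argument of [mu] vanish. *)
  have pixx : pi_act (x *m x^T) mu = fun Y Z => x *m x^T *m mu Y Z.
    apply/funext => Y; apply/funext => Z; rewrite /pi_act -![x *m _ *m _]mulmxA.
    rewrite [x^T *m Y]mx11_scalar [x^T *m Z]mx11_scalar !mul_mx_scalar.
    by rewrite inVZl // inVZr // [mu Y x]inVC // !mux !oppr0 !scaler0 !subr0.
  have mxx : 0 <= dotM m (x *m x^T).
    rewrite momentP // mulr_ge0 ?invr_ge0 ?(ltW nrm_gt0) // pixx.
    apply: sumr_ge0 => i _; apply: sumr_ge0 => j _.
    set y := mu _ _.
    have -> : \sum_k (x *m x^T *m y) k 0 * y k 0 = ((x^T *m y) 0 0) ^+ 2.
      rewrite -mulmxA [x^T *m y]mx11_scalar mul_mx_scalar.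
      rewrite [in RHS]mxE eqxx mulr1n expr2 {3}[(x^T *m y) 0 0]mxE mulr_sumr.
      by apply: eq_bigr => k _; rewrite !mxE; ring.
    exact: sqr_ge0.
  have dxx B : dotM B (x *m x^T) = (x^T *m (B *m x)) 0 0.
    by rewrite /dotM symxx mulmxA mxtrace_mulC trace_mx11.
  have : 0 <= dotM S (x *m x^T).
    rewrite /S /beta_plus dotMDl addr_ge0 // dotM_scalar mulr_ge0 ?dotM_ge0 //.
    by rewrite mxtrace_mulC trace_mx11 ltW.
  by rewrite dxx Sx -scalemxAr mxE pmulr_lge0.
pose C := A *m A^T - A^T *m A.
have symC : sym C by rewrite /sym /C linearB /= !trmx_mul !trmxK.
have trC : \tr C = 0 by rewrite linearB /= mxtrace_mulC subrr.
(* [S] and [m] differ by a multiple of the identity, which is orthogonal to the traceless [C]. *)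
have mS : dotM m C = dotM S C.
  by rewrite /S /beta_plus dotMDl dotM_scalar trC mulr0 addr0.
have SC : dotM S C = c * dotM A A.
  rewrite -dotMZl -SA /dotM symC /C mulmxBr mulmxBl !linearB /= !mulmxA.
  by congr (_ - _); rewrite mxtrace_mulC mulmxA.
(* pi(C) = pi(A) pi(A^T) - pi(A^T) pi(A), and pi(A) mu = 0 by the Jacobi identity; moving the outer
   pi(A) across the scalar product leaves |pi(A^T) mu|^2. *)
have : 0 <= dotM m C.
  rewrite momentP // mulr_ge0 ?invr_ge0 ?(ltW nrm_gt0) //.
  rewrite pi_act_commutator // pi_act_ad //.
  have -> : pi_act A^T (0 : bracket R N) = 0.
    by apply/funext => Y; apply/funext => Z; rewrite /pi_act mulmx0 !subr0.
  by rewrite subr0 pi_act_adjoint ?dotV_ge0 //; exact: inV_pi_act.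
rewrite mS SC pmulr_lge0 // lt_neqAle dotM_ge0 andbT eq_sym.
by apply: contra A0 => /eqP/dotM_eq0 ->.
Qed.

End Derivations.

(** * Gradient of the energy *)

Section DerivativeRules.
Variable R : realType.
Implicit Types (f g : R -> R) (t a b : R).

(* Stated over [R] itself, so that derivatives are sums and products in [R]
   rather than in the normed module over itself. *)
Definition has_derivative f t a : Prop := is_derive t 1 f a.

Lemma has_derivative_eq f t a b :
  has_derivative f t a -> a = b -> has_derivative f t b.
Proof. by move=> ? <-. Qed.

Lemma has_derivative_cst t a : has_derivative (fun=> a) t 0.
Proof. exact: is_derive_cst. Qed.

Lemma has_derivative_id t : has_derivative id t 1.
Proof. exact: is_derive_id. Qed.

Lemma has_derivativeD f g t a b : has_derivative f t a ->
  has_derivative g t b -> has_derivative (fun s => f s + g s) t (a + b).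
Proof. by move=> df dg; apply: is_deriveD. Qed.

Lemma has_derivativeB f g t a b : has_derivative f t a ->
  has_derivative g t b -> has_derivative (fun s => f s - g s) t (a - b).
Proof. by move=> df dg; apply: is_deriveB. Qed.

Lemma has_derivativeM f g t a b : has_derivative f t a ->
  has_derivative g t b ->
  has_derivative (fun s => f s * g s) t (a * g t + f t * b).
Proof.
move=> df dg; apply: is_derive_eq (is_deriveM df dg) _.
by rewrite addrC [a * _]mulrC.
Qed.

Lemma has_derivativeZ c f t a : has_derivative f t a ->
  has_derivative (fun s => c * f s) t (c * a).
Proof.
move=> df; have := has_derivativeM (has_derivative_cst t c) df.
by rewrite mul0r add0r.
Qed.

Lemma has_derivativeV f t a : f t != 0 -> has_derivative f t a ->
  has_derivative (fun s => (f s)^-1) t (- (f t) ^- 2 * a).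
Proof.
move=> ft [df fa]; apply: DeriveDef; first exact: derivableV.
by rewrite deriveV // fa.
Qed.

Lemma has_derivative_sum (I : Type) (r : seq I) (f : I -> R -> R) t
    (a : I -> R) :
  (forall i, has_derivative (f i) t (a i)) ->
  has_derivative (fun s => \sum_(i <- r) f i s) t (\sum_(i <- r) a i).
Proof.
move=> df; have -> : (fun s => \sum_(i <- r) f i s) = \sum_(i <- r) f i.
  by apply/funext => s; rewrite fct_sumE.
elim/big_ind2 : _ => // [|*]; [exact: is_derive_cst|exact: is_deriveD].
Qed.

Lemma has_derivative_inj f t a b :
  has_derivative f t a -> has_derivative f t b -> a = b.
Proof. by move=> [_ <-] [_ <-]. Qed.

End DerivativeRules.

Section MomentDerivative.
Variables (R : realType) (N : nat).
Implicit Types (mu nu v : bracket R N) (A B : 'M[R]_N).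

(** The symmetric matrices whose pairings are the entries of [moment]. *)
Definition sym_delta (i j : 'I_N) : 'M[R]_N :=
  2^-1 *: (delta_mx i j + delta_mx j i).

Lemma sym_delta_sym i j : (sym_delta i j)^T = sym_delta i j.
Proof. by rewrite /sym_delta linearZ /= linearD /= !trmx_delta addrC. Qed.

Lemma sum_sym_delta A : sym A -> \sum_i \sum_j A i j *: sym_delta i j = A.
Proof.
move=> symA.
have E1 : \sum_i \sum_j A i j *: delta_mx i j = A.
  by rewrite [RHS]matrix_sum_delta.
have E2 : \sum_i \sum_j A i j *: delta_mx j i = A.
  rewrite exchange_big /= -[RHS]E1; do 2!(apply: eq_bigr => ? _).
  by rewrite -[in LHS]symA mxE.
transitivity (2^-1 *: (\sum_i \sum_j A i j *: delta_mx i j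
                       + \sum_i \sum_j A i j *: delta_mx j i)).
  rewrite -big_split scaler_sumr; apply: eq_bigr => i _ /=.
  rewrite -big_split scaler_sumr; apply: eq_bigr => j _ /=.
  by rewrite /sym_delta -scalerDr !scalerA mulrC.
by rewrite E1 E2; apply/matrixP => i j; rewrite !mxE; field.
Qed.

Definition arr_moment (T : 'I_N -> 'I_N -> 'I_N -> R) (i j : 'I_N) : R :=
  (arr_dot T T)^-1 * arr_dot (arr_pi (sym_delta i j) T) T.

Lemma coef_pi_actE mu A : inV mu -> coef (pi_act A mu) = arr_pi A (coef mu).
Proof. by move=> ?; do 3!apply/funext => ?; exact: coef_pi_act. Qed.

Lemma momentE mu i j : inV mu -> moment mu i j = arr_moment (coef mu) i j.
Proof. by move=> Vmu; rewrite mxE -/(sym_delta i j) !dotVE coef_pi_actE. Qed.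

Definition arr_energy (T : 'I_N -> 'I_N -> 'I_N -> R) : R :=
  \sum_i \sum_j arr_moment T i j * arr_moment T i j.

Lemma energyE mu : inV mu -> energy mu = arr_energy (coef mu).
Proof.
by move=> Vmu; rewrite /energy dotME; do 2!(apply: eq_bigr => ? _);
   rewrite momentE.
Qed.

Section Curve.
Variables (T U : R -> 'I_N -> 'I_N -> 'I_N -> R) (t : R).
Variables (T' U' : 'I_N -> 'I_N -> 'I_N -> R).
Hypothesis dT : forall i j k, has_derivative (fun s => T s i j k) t (T' i j k).
Hypothesis dU : forall i j k, has_derivative (fun s => U s i j k) t (U' i j k).

Lemma has_derivative_arr_dot :
  has_derivative (fun s => arr_dot (T s) (U s)) t
    (arr_dot T' (U t) + arr_dot (T t) U').
Proof.
rewrite /arr_dot -big_split; apply: has_derivative_sum => i /=.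
rewrite -big_split; apply: has_derivative_sum => j /=.
rewrite -big_split; apply: has_derivative_sum => k /=.
exact: has_derivativeM.
Qed.

Lemma has_derivative_arr_pi A i j k :
  has_derivative (fun s => arr_pi A (T s) i j k) t (arr_pi A T' i j k).
Proof.
apply: has_derivativeB; first apply: has_derivativeB.
all: by apply: has_derivative_sum => l; exact: has_derivativeZ.
Qed.

End Curve.

Section MomentCurve.
Variables (T : R -> 'I_N -> 'I_N -> 'I_N -> R) (t : R).
Variable (T' : 'I_N -> 'I_N -> 'I_N -> R).
Hypothesis dT : forall i j k, has_derivative (fun s => T s i j k) t (T' i j k).
Hypothesis T0 : arr_dot (T t) (T t) != 0.

(** Quotient rule. As [sym_delta i j] is symmetric, its action is self-adjoint and the two terms
    from differentiating the numerator coincide; hence the factor 2. *)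
Lemma has_derivative_arr_moment i j :
  has_derivative (fun s => arr_moment (T s) i j) t
    (2 * (arr_dot (T t) (T t))^-1 *
       (arr_dot (arr_pi (sym_delta i j) (T t)) T'
        - arr_dot (T t) T' * arr_moment (T t) i j)).
Proof.
pose E := sym_delta i j.
suff D : has_derivative (fun s => arr_moment (T s) i j) t
  (- (arr_dot (T t) (T t)) ^- 2 * (arr_dot T' (T t) + arr_dot (T t) T')
     * arr_dot (arr_pi E (T t)) (T t)
   + (arr_dot (T t) (T t))^-1
     * (arr_dot (arr_pi E T') (T t) + arr_dot (arr_pi E (T t)) T')).
  apply: has_derivative_eq D _.
  rewrite [arr_dot (arr_pi E T') _]arr_pi_adjoint sym_delta_sym -/E.
  rewrite /arr_moment -/E [arr_dot T' (T t)]arr_dotC [arr_dot T' _]arr_dotC.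
  by field.
apply: has_derivativeM; first exact/has_derivativeV/has_derivative_arr_dot.
by apply: has_derivative_arr_dot => // *; exact: has_derivative_arr_pi.
Qed.

(** The squares in the energy contribute a second factor 2 to the derivative of the moment map. *)
Lemma has_derivative_arr_energy :
  has_derivative (fun s => arr_energy (T s)) t
    (4 * (arr_dot (T t) (T t))^-1 *
     (\sum_i \sum_j arr_moment (T t) i j *
         arr_dot (arr_pi (sym_delta i j) (T t)) T'
      - arr_dot (T t) T' * arr_energy (T t))).
Proof.
have D i j := has_derivativeM (has_derivative_arr_moment i j)
  (has_derivative_arr_moment i j).
apply: has_derivative_eq
  (has_derivative_sum _ (fun i => has_derivative_sum _ (fun j => D i j))) _.
rewrite /arr_energy mulr_sumr -sumrB mulr_sumr; apply: eq_bigr => i _.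
rewrite mulr_sumr -sumrB mulr_sumr; apply: eq_bigr => j _.
ring.
Qed.

End MomentCurve.

Lemma pi_act1 mu (a : R) : inV mu -> pi_act a%:M mu = (- a) *: mu.
Proof.
move=> Vmu; apply/funext => X; apply/funext => Y.
rewrite /pi_act !mul_scalar_mx (inVZl Vmu) (inVZr Vmu) !fctE.
by rewrite subrr sub0r scaleNr.
Qed.

Lemma pi_actDl mu A B : inV mu -> pi_act (A + B) mu = pi_act A mu + pi_act B mu.
Proof.
move=> Vmu; apply/funext => X; apply/funext => Y.
rewrite !fctE /pi_act !mulmxDl (inVDl Vmu) (inVDr Vmu).
by apply/matrixP => i j; rewrite !mxE; ring.
Qed.

Lemma pi_actZl a mu A : inV mu -> pi_act (a *: A) mu = a *: pi_act A mu.
Proof.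
move=> Vmu; apply/funext => X; apply/funext => Y; rewrite !fctE /pi_act.
by rewrite -!scalemxAl (inVZl Vmu) (inVZr Vmu) !scalerBr.
Qed.

Lemma inVD mu nu : inV mu -> inV nu -> inV (mu + nu).
Proof.
move=> Vmu Vnu; split=> [a X Y Z|X Y]; rewrite !fctE.
  by rewrite Vmu.1 Vnu.1 scalerDr addrACA.
by rewrite opprD -Vmu.2 -Vnu.2.
Qed.

Lemma inVZ a mu : inV mu -> inV (a *: mu).
Proof.
move=> Vmu; split=> [b X Y Z|X Y]; rewrite !fctE.
  by rewrite Vmu.1 scalerDr !scalerA mulrC.
by rewrite -scalerN -Vmu.2.
Qed.

(** For [A] the moment matrix of [mu], the right-hand side is the sum that appears in the derivative
    of the energy. *)
Lemma dotV_pi_act_sum mu v A : inV mu -> inV v -> sym A ->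
  dotV (pi_act A mu) v =
  \sum_i \sum_j A i j * dotV (pi_act (sym_delta i j) mu) v.
Proof.
move=> Vmu Vv symA; pose L B := dotV (pi_act B mu) v.
have LDZ a B C : L (a *: B + C) = a * L B + L C.
  by rewrite /L pi_actDl // pi_actZl // dotVDl.
have LD B C : L (B + C) = L B + L C by rewrite -[B]scale1r LDZ mul1r scale1r.
have L0 : L 0 = 0 by apply: (addrI (L 0)); rewrite -LD !addr0.
have LZ a B : L (a *: B) = a * L B by rewrite -[a *: B]addr0 LDZ L0 addr0.
rewrite -/(L A) -{1}(sum_sym_delta symA) (big_morph L LD L0).
apply: eq_bigr => i _; rewrite (big_morph L LD L0).
by apply: eq_bigr => j _; rewrite LZ.
Qed.

(** The derivative of the energy in direction [v] is 4 / |mu|^2 times <pi(m) mu - |m|^2 mu, v>.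
    Since pi(Id) mu = - mu, subtracting |m|^2 mu amounts to adding |m|^2 Id to m, which gives
    [beta_plus]. *)
Lemma gradient_energy mu (G : bracket R N) : inV mu -> mu != 0 ->
  is_gradient mu G ->
  G = (4 * (dotV mu mu)^-1) *: pi_act (beta_plus (moment mu)) mu.
Proof.
move=> Vmu mu0 [VG dE]; set m := moment mu; set H := RHS.
have nrm0 : dotV mu mu != 0 by rewrite gt_eqF // dotV_gt0.
have VH : inV H by apply: inVZ; exact: inV_pi_act.
have GH v : inV v -> dotV G v = dotV H v.
  move=> Vv; have := dE v Vv; move/has_derivative_inj; apply.
  have -> : (fun s : R => energy (mu + s *: v))
      = (fun s => arr_energy (coef (mu + s *: v))).
    by apply/funext => s; rewrite energyE //; apply: inVD => //; exact: inVZ.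
  have mu00 : mu + 0 *: v = mu by rewrite scale0r addr0.
  have dT i j k :
      has_derivative (fun s => coef (mu + s *: v) i j k) 0 (coef v i j k).
    have -> : (fun s => coef (mu + s *: v) i j k)
        = (fun s => coef mu i j k + s * coef v i j k).
      by apply/funext => s; rewrite /coef !fctE !mxE.
    apply: has_derivative_eq (has_derivativeD (has_derivative_cst _ _)
      (has_derivativeM (has_derivative_id _) (has_derivative_cst _ _))) _.
    by rewrite add0r mul1r mul0r addr0.
  have := has_derivative_arr_energy dT; rewrite mu00 -dotVE => /(_ nrm0).
  move=> D; apply: has_derivative_eq D _.
  rewrite /H dotVZl; congr (_ * _).
  rewrite /beta_plus pi_actDl // pi_act1 // -/(energy mu) energyE //.
  rewrite [pi_act m mu + _]addrC dotVDl mulNr [RHS]addrC.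
  congr (_ - _); last by rewrite mulrC.
  rewrite dotV_pi_act_sum //; last exact: moment_sym.
  do 2!(apply: eq_bigr => ? _); rewrite /m momentE // !dotVE.
  by rewrite coef_pi_actE.
(* [G] and [H] pair equally with every element of V, in particular with [G - H] itself. *)
have VGH : inV (G - H) by rewrite -scaleN1r; apply: inVD => //; exact: inVZ.
apply/eqP; rewrite -subr_eq0; apply/eqP/dotV_eq0 => //.
transitivity (dotV ((-1) *: H + G) (G - H)); first by rewrite scaleN1r addrC.
by rewrite dotVDl GH // mulN1r addNr.
Qed.

End MomentDerivative.

(** * The Jacobi identity along the gradient flow *)

Section LinearODE.
Variable R : realType.
Implicit Types (f : R -> R) (t T : R).

Lemma has_derivative_within f f' T :
  (forall t, 0 <= t -> has_derivative f t (f' t)) ->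
  {within `[0, T], continuous f}.
Proof.
move=> df; apply: derivable_within_continuous => t.
by rewrite in_itv /= => /andP[t0 _]; have [] := df t t0.
Qed.

Lemma has_derivative_bounded f f' T : 0 <= T ->
  (forall t, 0 <= t -> has_derivative f t (f' t)) ->
  exists C, forall t, 0 <= t <= T -> f t <= C.
Proof.
move=> T0 df; have [s _ fs] := EVT_max T0 (has_derivative_within df (T := T)).
by exists (f s) => t tT; apply: fs; rewrite in_itv.
Qed.

(** The derivative of [f t * expR (- K * t)] is nonpositive on the interval, so this product stays
    below its initial value [f 0]. *)
Lemma gronwall f f' (K T : R) : 0 <= T ->
  (forall t, 0 <= t -> has_derivative f t (f' t)) ->
  (forall t, 0 <= t <= T -> f' t <= K * f t) ->
  f 0 <= 0 -> f T <= 0.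
Proof.
move=> T0 df f'K f0.
pose g t := f t * expR (- K * t).
pose g' t := (f' t - K * f t) * expR (- K * t).
have dg t : 0 <= t -> has_derivative g t (g' t).
  move=> t0.
  have dK := has_derivativeZ (- K) (has_derivative_id t).
  have dE : has_derivative (fun s => expR (- K * s)) t (- K * expR (- K * t)).
    have H := @is_derive1_comp R expR ( *%R (- K)) t _ _ (is_derive_expR _) dK.
    by apply: has_derivative_eq H _; rewrite /= mulr1 [LHS]mulrC.
  apply: has_derivative_eq (has_derivativeM (df t t0) dE) _.
  by rewrite /g'; ring.
have gT : g T <= g 0.
  have D t : t \in `]0, T[%R -> derivable g t 1 /\ derive1 g t <= 0.
    rewrite in_itv /= => /andP[/ltW t0 /ltW tT].
    have [dgt gt] := dg t t0; split=> //; rewrite derive1E gt.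
    by rewrite mulr_le0_ge0 ?expR_ge0 // subr_le0 f'K ?t0.
  apply: (ler0_derive1_le_cc (a := 0) (b := T));
    rewrite ?in_itv /= ?lexx ?T0 //.
  - by move=> t /D[].
  - by move=> t /D[].
  - exact: has_derivative_within dg.
have : g T <= 0.
  by apply: le_trans gT _; rewrite /g mulr0 expR0 mulr1.
by rewrite /g pmulr_lle0 ?expR_gt0.
Qed.

(** Linearity of the system with locally bounded coefficients enters as the bound of [y'] by a
    multiple of any bound on [y]. Gronwall's inequality is applied to the sum of the squares. *)
Lemma linear_ode_eq0 (I : finType) (y y' : I -> R -> R) :
  (forall a t, 0 <= t -> has_derivative (y a) t (y' a t)) ->
  (forall T, 0 <= T -> exists C, 0 <= C /\ forall a t B, 0 <= t <= T ->
     (forall b, `|y b t| <= B) -> `|y' a t| <= C * B) ->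
  (forall a, y a 0 = 0) -> forall a t, 0 <= t -> y a t = 0.
Proof.
move=> dy bnd y0 a T T0; have [C [C0 y'C]] := bnd T T0.
pose f t := \sum_a y a t * y a t.
pose f' t := \sum_a (y' a t * y a t + y a t * y' a t).
have df t : 0 <= t -> has_derivative f t (f' t).
  move=> t0; apply: has_derivative_sum => b.
  by apply: has_derivativeM; exact: dy.
have yf b t : `|y b t| <= Num.sqrt (f t).
  rewrite -sqrtr_sqr ler_wsqrtr // /f (bigD1 b) //= expr2 lerDl.
  by apply: sumr_ge0 => c _; exact: sqr_ge0.
have f_ge0 t : 0 <= f t by apply: sumr_ge0 => b _; exact: sqr_ge0.
have fT : f T <= 0.
  (* Each index contributes 2 y y' to the derivative, at most 2 C f because every |y| is at most the
     square root of [f]. *)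
  apply: (gronwall (K := \sum_(b : I) (C + C)) T0 df) => [t tT|].
    rewrite mulr_suml; apply: ler_sum => b _.
    have H : y' b t * y b t <= C * f t.
      rewrite (le_trans (ler_norm _)) // normrM.
      rewrite -[f t]sqr_sqrtr // expr2 mulrA ler_pM //.
      by apply: y'C => // c; exact: yf.
    by rewrite mulrDl lerD // mulrC.
  by rewrite /f big1 // => b _; rewrite y0 mul0r.
have {fT} : f T = 0 by apply/eqP; rewrite eq_le fT f_ge0.
move/psumr_eq0P => /(_ (fun b _ => sqr_ge0 _)) /(_ a isT)/eqP.
by rewrite mulf_eq0 orbb => /eqP.
Qed.

End LinearODE.

Section JacobiFlow.
Variables (R : realType) (N : nat).
Implicit Types (mu nu : bracket R N) (A : 'M[R]_N) (X Y Z : 'cV[R]_N).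

(** The Jacobiator is quadratic in the bracket. Separating the inner bracket [mu] from the outer one
    [nu] makes it bilinear, as the product rule requires. *)
Definition jacobiator mu nu X Y Z : 'cV[R]_N :=
  nu X (mu Y Z) - nu (mu X Y) Z - nu Y (mu X Z).

Definition arr_jac (T U : 'I_N -> 'I_N -> 'I_N -> R) (i j k m : 'I_N) : R :=
  \sum_l T j k l * U i l m - \sum_l T i j l * U l k m
  - \sum_l T i k l * U j l m.

Lemma arr_jacE mu nu i j k m : inV nu ->
  arr_jac (coef mu) (coef nu) i j k m
  = jacobiator mu nu (bvec R i) (bvec R j) (bvec R k) m 0.
Proof.
move=> Vnu.
rewrite /jacobiator [mu (bvec R j) (bvec R k)]cV_bvec.
rewrite [mu (bvec R i) (bvec R j)]cV_bvec [mu (bvec R i) (bvec R k)]cV_bvec.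
rewrite (inV_suml Vnu) !(inV_sumr Vnu) !mxE !summxE.
by congr (_ - _ - _); apply: eq_bigr => l _;
  rewrite ?(inVZl Vnu) ?(inVZr Vnu) mxE.
Qed.

Lemma jacobiatorP mu : jacobi mu <-> forall X Y Z, jacobiator mu mu X Y Z = 0.
Proof.
split=> J X Y Z; last first.
  have /eqP := J X Y Z.
  by rewrite /jacobiator subr_eq0 subr_eq addrC => /eqP.
by rewrite /jacobiator J addrAC addrK subrr.
Qed.

Section Multilinear.
Variable mu : bracket R N.
Hypothesis Vmu : inV mu.
Let J := jacobiator mu mu.

Lemma jacobiator_sum1 I (r : seq I) (a : I -> R) F Y Z :
  J (\sum_(i <- r) a i *: F i) Y Z = \sum_(i <- r) a i *: J (F i) Y Z.
Proof.
rewrite /J /jacobiator !(inV_suml Vmu) (inV_sumr Vmu) -!sumrB.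
apply: eq_bigr => i _.
by rewrite !(inVZl Vmu) (inVZr Vmu) !scalerBr.
Qed.

Lemma jacobiator_sum2 I (r : seq I) (a : I -> R) F X Z :
  J X (\sum_(i <- r) a i *: F i) Z = \sum_(i <- r) a i *: J X (F i) Z.
Proof.
rewrite /J /jacobiator (inV_suml Vmu _ _ Z) (inV_suml Vmu _ _ (mu X Z)).
rewrite !(inV_sumr Vmu) (inV_suml Vmu _ _ Z) -!sumrB.
apply: eq_bigr => i _.
by rewrite !(inVZl Vmu) !(inVZr Vmu) (inVZl Vmu) !scalerBr.
Qed.

Lemma jacobiator_sum3 I (r : seq I) (a : I -> R) F X Y :
  J X Y (\sum_(i <- r) a i *: F i) = \sum_(i <- r) a i *: J X Y (F i).
Proof.
rewrite /J /jacobiator !(inV_sumr Vmu) -!sumrB.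
apply: eq_bigr => i _.
by rewrite !(inVZr Vmu) !scalerBr.
Qed.

(** Infinitesimal equivariance of the Jacobiator under GL(g): the right-hand side is the derived
    action of [A] on a trilinear map. Hence the variation of the Jacobiator along pi(A) mu is linear
    in the Jacobiator. *)
Lemma jacobiator_pi_act A X Y Z :
  jacobiator (pi_act A mu) mu X Y Z + jacobiator mu (pi_act A mu) X Y Z
  = A *m J X Y Z - J (A *m X) Y Z - J X (A *m Y) Z - J X Y (A *m Z).
Proof.
rewrite /J /jacobiator /pi_act !mulmxBr.
rewrite !(inVBl Vmu) !(inVBr Vmu).
by apply/matrixP => i j; rewrite !mxE; ring.
Qed.

Lemma arr_jac_pi_act A i j k m :
  arr_jac (arr_pi A (coef mu)) (coef mu) i j k m
  + arr_jac (coef mu) (arr_pi A (coef mu)) i j k m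
  = \sum_l A m l * arr_jac (coef mu) (coef mu) i j k l
    - \sum_l A l i * arr_jac (coef mu) (coef mu) l j k m
    - \sum_l A l j * arr_jac (coef mu) (coef mu) i l k m
    - \sum_l A l k * arr_jac (coef mu) (coef mu) i j l m.
Proof.
have VA := inV_pi_act Vmu A.
rewrite -coef_pi_actE // !arr_jacE //.
have := jacobiator_pi_act A (bvec R i) (bvec R j) (bvec R k).
move/matrixP/(_ m 0); rewrite [LHS]mxE => ->.
rewrite !mul_bvec jacobiator_sum1 jacobiator_sum2 jacobiator_sum3.
rewrite !mxE !summxE; congr (_ - _ - _ - _); apply: eq_bigr => l _;
  by rewrite arr_jacE // mxE.
Qed.

Lemma jacobi_coef : (forall i j k m, arr_jac (coef mu) (coef mu) i j k m = 0) ->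
  jacobi mu.
Proof.
move=> J0; apply/jacobiatorP => X Y Z; rewrite -/(J X Y Z).
rewrite [X]cV_bvec jacobiator_sum1 big1 // => i _.
rewrite [Y]cV_bvec jacobiator_sum2 big1 ?scaler0 // => j _.
rewrite [Z]cV_bvec jacobiator_sum3 big1 ?scaler0 // => k _.
have -> : J (bvec R i) (bvec R j) (bvec R k) = 0; last by rewrite scaler0.
by apply/matrixP => m l; rewrite ord1 -arr_jacE // J0 mxE.
Qed.

Lemma coef_jacobi : jacobi mu ->
  forall i j k m, arr_jac (coef mu) (coef mu) i j k m = 0.
Proof. by move=> /jacobiatorP J0 i j k m; rewrite arr_jacE // J0 mxE. Qed.

End Multilinear.

Lemma has_derivative_arr_jac (T : R -> 'I_N -> 'I_N -> 'I_N -> R) t T' i j k m :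
  (forall i j k, has_derivative (fun s => T s i j k) t (T' i j k)) ->
  has_derivative (fun s => arr_jac (T s) (T s) i j k m) t
    (arr_jac T' (T t) i j k m + arr_jac (T t) T' i j k m).
Proof.
move=> dT; rewrite /arr_jac.
have D (f g : 'I_N -> R -> R) (f' g' : 'I_N -> R) :
    (forall l, has_derivative (f l) t (f' l)) ->
    (forall l, has_derivative (g l) t (g' l)) ->
    has_derivative (fun s => \sum_l f l s * g l s) t
      (\sum_l f' l * g l t + \sum_l f l t * g' l).
  move=> df dg; rewrite -big_split.
  by apply: has_derivative_sum => l; exact: has_derivativeM.
apply: has_derivative_eq.
  apply: has_derivativeB; first apply: has_derivativeB.
  - exact: D (fun l => dT j k l) (fun l => dT i l m).
  - exact: D (fun l => dT i j l) (fun l => dT l k m).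
  - exact: D (fun l => dT i k l) (fun l => dT j l m).
by ring.
Qed.

(** The flow is tangent to the GL(g)-orbits, so the entries of the Jacobiator form a system as in
    [linear_ode_eq0]; its coefficients are bounded on compact intervals because they are
    differentiable. *)
Lemma flow_jacobi (c : R -> bracket R N) : neg_gradient_flow c ->
  jacobi (c 0) -> forall t, 0 <= t -> jacobi (c t).
Proof.
move=> flow J0.
pose T t := coef (c t).
(* For [0 <= t], [S t] holds the entries of [beta_plus (moment (c t))], and [A t] is the multiple of
   it for which the flow equation reads T' = pi(A) T. *)
pose S t i j : R := arr_moment (T t) i j + arr_energy (T t) *+ (i == j).
pose A t : 'M[R]_N :=
  \matrix_(i, j) (- (4 * (arr_dot (T t) (T t))^-1) * S t i j).
have Vc t : 0 <= t -> inV (c t) by move=> /flow[].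
have T0 t : 0 <= t -> arr_dot (T t) (T t) != 0.
  by move=> /flow[Vct [ct0 _]]; rewrite -dotVE gt_eqF // dotV_gt0.
have dT t : 0 <= t -> forall i j k,
    has_derivative (fun s => T s i j k) t (arr_pi (A t) (T t) i j k).
  move=> t0 i j k.
  have [Vct [ct0 [G [/(gradient_energy Vct ct0) GE]]]] := flow t t0.
  move/(_ (bvec R i) (bvec R j) k) => D; apply: has_derivative_eq D _.
  rewrite GE -coef_pi_actE // /coef !fctE.
  have -> : A t =
      (- (4 * (arr_dot (T t) (T t))^-1)) *: beta_plus (moment (c t)).
    apply/matrixP => a b; rewrite !mxE; congr (_ * _).
    by rewrite -/(energy (c t)) energyE // /S -momentE // mxE.
  by rewrite pi_actZl // !fctE !mxE mulNr.
(* Squares are used because [has_derivative_bounded] bounds from above only, whereas the absolute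
   values of the entries are wanted. *)
have dA i j : exists A' : R -> R, forall t, 0 <= t ->
    has_derivative (fun s => A s i j * A s i j) t (A' t).
  have {}dA : exists A' : R -> R, forall t, 0 <= t ->
      has_derivative (fun s => A s i j) t (A' t).
    eexists => t t0.
    have -> : (fun s => A s i j) =
       (fun s => (-4) * (arr_dot (T s) (T s))^-1 *
          (arr_moment (T s) i j + arr_energy (T s) * (i == j)%:R)).
      by apply/funext => s; rewrite mxE /S mulr_natr mulNr.
    apply: has_derivativeM.
      apply/has_derivativeZ/has_derivativeV; first exact: T0.
      by apply: has_derivative_arr_dot; exact: dT.
    apply: has_derivativeD.
      by apply: has_derivative_arr_moment; [exact: dT|exact: T0].
    apply: has_derivativeM; last exact: has_derivative_cst.
    by apply: has_derivative_arr_energy; [exact: dT|exact: T0].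
  have [A' dA'] := dA; eexists => t t0.
  by apply: has_derivativeM; exact: dA'.
pose I := ('I_N * 'I_N * 'I_N * 'I_N)%type.
pose y (a : I) t := arr_jac (T t) (T t) a.1.1.1 a.1.1.2 a.1.2 a.2.
pose y' (a : I) t :=
  arr_jac (arr_pi (A t) (T t)) (T t) a.1.1.1 a.1.1.2 a.1.2 a.2
  + arr_jac (T t) (arr_pi (A t) (T t)) a.1.1.1 a.1.1.2 a.1.2 a.2.
have y0 a t : 0 <= t -> y a t = 0.
  move: a t; apply: (linear_ode_eq0 (y' := y')).
  - by move=> a t t0; apply: has_derivative_arr_jac; exact: dT.
  - move=> U U0.
    have /choice[C0 C0P] : forall ij : 'I_N * 'I_N, exists C, forall t,
        0 <= t <= U -> A t ij.1 ij.2 * A t ij.1 ij.2 <= C.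
      move=> [i j]; have [A' dA'] := dA i j.
      exact: has_derivative_bounded U0 dA'.
    (* One constant for all entries: u <= 1 + u^2 bounds each by its own summand, and the summands
       are nonnegative. *)
    pose C := \sum_ij (1 + `|C0 ij|).
    have C_ge0 : 0 <= C by apply: sumr_ge0 => ij _; rewrite addr_ge0.
    have AC i j t : 0 <= t <= U -> `|A t i j| <= C.
      move=> tU; apply: (@le_trans _ _ (1 + `|C0 (i, j)|)).
        have := C0P (i, j) t tU.
        rewrite /= -expr2 -real_normK ?num_real // => H.
        have := le_trans H (ler_norm _); set u := `|A t i j|.
        have : 0 <= (u - 1) ^+ 2 := sqr_ge0 _.
        have : 0 <= u by rewrite /u.
        by nra.
      rewrite /C (bigD1 (i, j)) //= lerDl; apply: sumr_ge0 => ij _.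
      by rewrite addr_ge0.
    (* [arr_jac_pi_act] has four sums, each of [N] products of size at most [C * B]. *)
    exists ((\sum_(l < N) C) *+ 4); split.
      by rewrite mulrn_wge0 // sumr_ge0.
    move=> [[[i j] k] m] t B tU yB; have t0 : 0 <= t by case/andP: tU.
    rewrite /y' /= (arr_jac_pi_act (Vc t t0)).
    have H (a b : 'I_N -> R) :
        (forall l, `|a l| <= C) -> (forall l, `|b l| <= B) ->
        `|\sum_l a l * b l| <= (\sum_(l < N) C) * B.
      move=> aC bB; apply: le_trans (ler_norm_sum _ _ _) _.
      rewrite mulr_suml; apply: ler_sum => l _.
      by rewrite normrM ler_pM.
    rewrite mulrnAl 3!mulrSr mulr1n.
    apply: le_trans (ler_normB _ _) _; apply: lerD.
      apply: le_trans (ler_normB _ _) _; apply: lerD.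
        by apply: le_trans (ler_normB _ _) _; apply: lerD; apply: H => l;
          rewrite ?AC //; [exact: (yB (i, j, k, l))|exact: (yB (l, j, k, m))].
      by apply: H => l; [exact: AC|exact: (yB (i, l, k, m))].
    by apply: H => l; [exact: AC|exact: (yB (i, j, l, m))].
  - by move=> a; apply: coef_jacobi => //; exact: Vc (lexx 0).
move=> t t0; apply: jacobi_coef => [|i j k m]; first exact: Vc t t0.
exact: (y0 (i, j, k, m) t t0).
Qed.

(** The Jacobiator is polynomial in the structure constants, which converge one by one. *)
Lemma flow_limit_jacobi (c : R -> bracket R N) lam :
  neg_gradient_flow c -> jacobi (c 0) -> flow_converges c lam -> inV lam ->
  jacobi lam.
Proof.
move=> flow J0 clam Vlam; apply: jacobi_coef => // i j k m.
have cT a b d : (fun t => coef (c t) a b d) @ +oo --> coef lam a b d.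
  exact: clam.
have cS (f g : 'I_N -> R -> R) (f' g' : 'I_N -> R) :
    (forall l, f l @ +oo --> f' l) -> (forall l, g l @ +oo --> g' l) ->
    (fun t => \sum_l f l t * g l t) @ +oo --> \sum_l f' l * g' l.
  move=> cf cg; apply: cvg_big => [|l _]; first exact: add_continuous.
  exact: cvgM.
have cJ : (fun t => arr_jac (coef (c t)) (coef (c t)) i j k m) @ +oo
    --> arr_jac (coef lam) (coef lam) i j k m.
  apply: cvgB; first apply: cvgB; by apply: cS => l; exact: cT.
have c0 : (fun t => arr_jac (coef (c t)) (coef (c t)) i j k m) @ +oo
    --> (0 : R).
  apply: cvg_near_cst; near=> t.
  have t0 : 0 <= t by near: t; exact: nbhs_pinfty_ge.
  by apply: coef_jacobi; [have [] := flow t t0|exact: flow_jacobi].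
exact: cvg_unique cJ c0.
Unshelve. all: by end_near.
Qed.

End JacobiFlow.
From mathcomp Require Import complex.

(** * Brackets in the nonnegative eigenspaces *)

(** Over the complex numbers [S] is Hermitian, hence similar to a real diagonal matrix. Real
    matrices that are similar over C are similar over R, and taking real parts descends the
    result. *)
Lemma sym_diagonalizable (R : realType) (N : nat) (S : 'M[R]_N) : sym S ->
  exists Q D, Q \in unitmx /\ Q *m S = diag_mx D *m Q.
Proof.
move=> symS.
pose C : numClosedFieldType := R[i].
pose toC : {rmorphism R -> C} := real_complex R.
have toC_real (x : R) : toC x \is Num.real by apply/complex_realP; exists x.
have realP m p (A : 'M[C]_(m, p)) : A \is a mxOver Num.real ->
    A = map_mx toC (map_mx (@complex.Re R) A).
  move=> /mxOverP realA; apply/matrixP => i j; rewrite !mxE.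
  by symmetry; exact: RRe_real.
pose Sc := map_mx toC S.
have Sc_real : Sc \is a mxOver Num.real by apply/mxOverP => i j; rewrite mxE.
have Sc_herm : Sc \is hermsymmx.
  apply: realsym_hermsym => //; apply/is_hermitianmxP.
  by rewrite expr0 scale1r map_mx_id // /Sc map_trmx symS.
have /hermitian_normalmx/orthomx_spectralP E := Sc_herm.
set P := spectralmx Sc in E; set D := spectral_diag Sc in E.
have P_unit : P \in unitmx := spectral_unit Sc.
have D_real : D \is a mxOver Num.real := hermitian_spectral_diag_real Sc_herm.
have dD_real : diag_mx D \is a mxOver Num.real.
  apply/mxOverP => i j; rewrite mxE; case: eqP => _; last exact: rpred0.
  by rewrite mulr1n; exact: (mxOverP D_real).
have [|Q] := @real_similar C N Sc (diag_mx D) _ Sc_real dD_real.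
  exists P => //; apply/similarP => //.
  by rewrite {1}E !mulmxA mulmxV // mul1mx.
rewrite inE => /andP[Q_real Q_unit] /(similarP Q_unit) QS.
exists (map_mx (@complex.Re R) Q), (map_mx (@complex.Re R) D); split.
  by rewrite -(map_unitmx toC) -realP.
apply: (@map_mx_inj _ _ toC); rewrite !map_mxM -realP //.
by rewrite map_diag_mx -realP.
Qed.

Section Nonnegative.
Variables (R : realType) (N : nat).
Implicit Types (mu nu : bracket R N) (S : 'M[R]_N).

Lemma fct_sum2E I (r : seq I) (F : I -> bracket R N) X Y :
  (\sum_(i <- r) F i) X Y = \sum_(i <- r) F i X Y.
Proof. by rewrite fct_sumE fct_sumE. Qed.

Lemma inV_sum I (r : seq I) (F : I -> bracket R N) :
  (forall i, inV (F i)) -> inV (\sum_(i <- r) F i).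
Proof.
move=> VF; elim/big_ind : _ => // [|mu nu]; last exact: inVD.
have z X Y : (0 : bracket R N) X Y = 0 by [].
by split=> *; rewrite !z ?scaler0 ?addr0 ?oppr0.
Qed.

Lemma inV_Vge0 S mu : Vge0 S mu -> inV mu.
Proof. by move=> [r [l [nu [H ->]]]]; apply: inV_sum => i; have [] := H i. Qed.

Lemma entry_bvec (A : 'M[R]_N) i j : A i j = (A *m bvec R j) i 0.
Proof. by rewrite -colE mxE. Qed.

Lemma eigenbasis (Q S : 'M[R]_N) (D : 'rV[R]_N) i :
  Q \in unitmx -> Q *m S = diag_mx D *m Q ->
  S *m (invmx Q *m bvec R i) = D 0 i *: (invmx Q *m bvec R i).
Proof.
move=> Qu QS.
have -> : S *m (invmx Q *m bvec R i) = invmx Q *m (diag_mx D *m bvec R i).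
  by rewrite -[S](mulKmx Qu) QS !mulmxA mulmxK // mulmxA.
rewrite scalemxAr; congr (_ *m _).
apply/matrixP => b c; rewrite mul_diag_mx !mxE.
by case: eqP => [->|]; rewrite ?mulr0.
Qed.

(** If [nu] is an eigenvector of pi(S) for the eigenvalue l, its coefficients in an eigenbasis of
    [S] satisfy (D_k - D_i - D_j) T_ijk = l T_ijk. With l >= 0 and D_k < D_i + D_j this forces T_ijk
    = 0. *)
Lemma eigen_coef_eq0 (Q S : 'M[R]_N) (D : 'rV[R]_N) mu i j k :
  Q \in unitmx -> Q *m S = diag_mx D *m Q -> Vge0 S mu ->
  D 0 k < D 0 i + D 0 j ->
  (Q *m mu (invmx Q *m bvec R i) (invmx Q *m bvec R j)) k 0 = 0.
Proof.
move=> Qu QS [r [l [nu [H ->]]]] Dlt.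
rewrite fct_sum2E mulmx_sumr summxE big1 // => a _.
have [Vnu la eig] := H a.
have SPe m := eigenbasis m Qu QS.
set x := invmx Q *m bvec R i; set y := invmx Q *m bvec R j.
have : Q *m pi_act S (nu a) x y = l a *: (Q *m nu a x y).
  by rewrite eig !fctE -scalemxAr.
rewrite /pi_act !SPe (inVZl Vnu) (inVZr Vnu) !mulmxBr -!scalemxAr.
rewrite mulmxA QS -mulmxA.
move/matrixP/(_ k 0); rewrite mul_diag_mx !mxE => /eqP.
rewrite -!mulrBl -subr_eq0 -mulrBl mulf_eq0 => /orP[/eqP E|/eqP //].
by lra.
Qed.

Lemma killing_formC mu X Y : killing_form mu X Y = killing_form mu Y X.
Proof. by rewrite /killing_form mxtrace_mulC. Qed.

Lemma killing_form_suml mu (I : finType) (a : I -> R) (x : I -> 'cV[R]_N) Y :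
  inV mu ->
  killing_form mu (\sum_i a i *: x i) Y = \sum_i a i * killing_form mu (x i) Y.
Proof.
move=> Vmu.
have ad_sum : ad_mx mu (\sum_i a i *: x i) = \sum_i a i *: ad_mx mu (x i).
  apply/matrixP => k l; rewrite mxE (inV_suml Vmu) !summxE.
  by apply: eq_bigr => i _; rewrite (inVZl Vmu) !mxE.
rewrite /killing_form ad_sum mulmx_suml raddf_sum; apply: eq_bigr => i _ /=.
by rewrite -scalemxAl mxtraceZ.
Qed.

(* In an eigenbasis of [S], [ad x] strictly raises the eigenvalue when [x] has a
   positive one, so that [ad x ad z] has zero diagonal. *)
Lemma killing_form_image_eq0 S mu y z : sym S ->
  (forall c (x : 'cV[R]_N), x != 0 -> S *m x = c *: x -> 0 <= c) ->
  Vge0 S mu -> killing_form mu (S *m y) z = 0.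
Proof.
move=> symS S_ge0 VSmu; have Vmu := inV_Vge0 VSmu.
have [Q [D [Qu QS]]] := sym_diagonalizable symS.
pose x i := invmx Q *m bvec R i.
have basis w : w = \sum_i (Q *m w) i 0 *: x i.
  rewrite -[LHS](mulKmx Qu) {1}[Q *m w]cV_bvec mulmx_sumr.
  by apply: eq_bigr => i _; rewrite -scalemxAr.
have Sx i : S *m x i = D 0 i *: x i := eigenbasis i Qu QS.
have D_ge0 i : 0 <= D 0 i.
  apply: S_ge0 (Sx i); apply/eqP => /(congr1 (mulmx Q)).
  rewrite mulKVmx // mulmx0 => /matrixP/(_ i 0)/eqP.
  by rewrite !mxE !eqxx oner_eq0.
pose T i j k := (Q *m mu (x i) (x j)) k 0.
have T0 i j k : D 0 k < D 0 i + D 0 j -> T i j k = 0.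
  exact: eigen_coef_eq0 Qu QS VSmu.
have conj_ad i k l : (Q *m ad_mx mu (x i) *m invmx Q) k l = T i l k.
  by rewrite entry_bvec -!mulmxA ad_mxE.
(* The trace is unchanged by conjugation with [Q], so it may be computed in the eigenbasis. *)
have K i j : killing_form mu (x i) (x j) = \sum_k \sum_l T i l k * T j k l.
  transitivity (\tr ((Q *m ad_mx mu (x i) *m invmx Q)
                    *m (Q *m ad_mx mu (x j) *m invmx Q))).
    rewrite !mulmxA mulmxKV // mxtrace_mulC !mulmxA mulVmx // mul1mx.
    by [].
  apply: eq_bigr => k _; rewrite mxE; apply: eq_bigr => l _.
  by rewrite !conj_ad.
rewrite [y]basis mulmx_sumr [z]basis.
under eq_bigr => i _ do rewrite -scalemxAr Sx scalerA.
rewrite killing_form_suml // big1 // => i _.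
rewrite killing_formC killing_form_suml // mulr_sumr big1 // => j _.
rewrite killing_formC.
have [Di0|Di0] := eqVneq (D 0 i) 0; first by rewrite Di0 mulr0 mul0r.
have {}Di0 : 0 < D 0 i by rewrite lt_neqAle eq_sym Di0 D_ge0.
rewrite K big1 ?mulr0 // => k _; rewrite big1 // => l _.
(* If neither factor vanished, then D_l >= D_j + D_k >= D_k >= D_i + D_l > D_l. *)
have [Dk|Dk] := ltP (D 0 k) (D 0 i + D 0 l); first by rewrite T0 ?mul0r.
rewrite [T j k l]T0 ?mulr0 //; have := D_ge0 j; lra.
Qed.

End Nonnegative.

(** * Pairing the modified Ricci curvature with a symmetric operator *)

Section ArraySums.
Variables (R : realType) (p : nat).
Implicit Types (T U : 'I_p -> 'I_p -> 'I_p -> R) (A : 'M[R]_p).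

Lemma arr_dot_suml I (r : seq I) (c : I -> R)
    (F : I -> 'I_p -> 'I_p -> 'I_p -> R) U :
  arr_dot (fun i j k => \sum_(a <- r) c a * F a i j k) U
  = \sum_(a <- r) c a * arr_dot (F a) U.
Proof.
rewrite /arr_dot.
under [RHS]eq_bigr => a _ do rewrite mulr_sumr.
rewrite [RHS]exchange_big; apply: eq_bigr => i _ /=.
under [RHS]eq_bigr => a _ do rewrite mulr_sumr.
rewrite [RHS]exchange_big; apply: eq_bigr => j _ /=.
under [RHS]eq_bigr => a _ do rewrite mulr_sumr.
rewrite [RHS]exchange_big; apply: eq_bigr => k _ /=.
by rewrite mulr_suml; apply: eq_bigr => a _; rewrite mulrA.
Qed.

(* Eigenvectors of a self-adjoint operator for distinct eigenvalues are
   orthogonal, so the left-hand side is the square norm of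
   [\sum_a sqrt (l a) F a]. *)
Lemma arr_pi_ge0 A r (l : 'I_r -> R) (F : 'I_r -> 'I_p -> 'I_p -> 'I_p -> R) T :
  sym A -> (forall a, 0 <= l a) ->
  (forall a i j k, arr_pi A (F a) i j k = l a * F a i j k) ->
  (forall i j k, T i j k = \sum_a F a i j k) ->
  0 <= arr_dot (arr_pi A T) T.
Proof.
move=> symA l0 eigF TF.
(* Self-adjointness of pi(A), evaluated on two eigenvectors. *)
have FA a b : l a * arr_dot (F a) (F b) = l b * arr_dot (F a) (F b).
  have E c : arr_pi A (F c) = fun i j k => l c * F c i j k.
    by do 3!apply/funext => ?.
  have S1 c U V : arr_dot (fun i j k => c * U i j k) V = c * arr_dot U V.
    rewrite /arr_dot mulr_sumr; apply: eq_bigr => i _.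
    rewrite mulr_sumr; apply: eq_bigr => j _.
    by rewrite mulr_sumr; apply: eq_bigr => k _; rewrite mulrA.
  rewrite -S1 -E arr_pi_adjoint symA E arr_dotC S1.
  by rewrite [arr_dot (F b) _]arr_dotC.
have AT : arr_pi A T = fun i j k => \sum_a l a * F a i j k.
  do 3!apply/funext => ?; rewrite /arr_pi.
  under [RHS]eq_bigr => a _ do rewrite -eigF.
  rewrite !sumrB; congr (_ - _ - _); rewrite exchange_big;
    by apply: eq_bigr => ? _; rewrite TF mulr_sumr.
have TE : T = fun i j k => \sum_a 1 * F a i j k.
  by do 3!apply/funext => ?; rewrite TF; apply: eq_bigr => a _; rewrite mul1r.
pose W i j k := \sum_a Num.sqrt (l a) * F a i j k.
suff -> : arr_dot (arr_pi A T) T = arr_dot W W by exact: arr_dot_ge0.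
rewrite AT {1}TE /W !arr_dot_suml; apply: eq_bigr => a _.
rewrite [in LHS]arr_dotC [in RHS]arr_dotC !arr_dot_suml !mulr_sumr.
apply: eq_bigr => b _; rewrite mul1r.
have [d0|d0] := eqVneq (arr_dot (F b) (F a)) 0; first by rewrite d0 !mulr0.
have /(mulIf d0) -> := FA b a.
by rewrite mulrA -expr2 sqr_sqrtr.
Qed.

End ArraySums.

Section ModifiedRicci.
Variables (R : realType) (d n : nat).
Implicit Types (mu nu : bracket R (d + n)) (S : 'M[R]_(d + n)) (A : 'M[R]_n).

Lemma mu_mE mu i j k :
  mu_m mu i j k = coef mu (rshift d i) (rshift d j) (rshift d k).
Proof. by rewrite /mu_m mxE. Qed.

(** Up to the factor 1/4 and normalization, [M_mu] is the moment map of [mu_m]. In <pi(A) T, T> the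
    value slot gives [P] and each argument slot gives [Q], the two agreeing by antisymmetry. *)
Lemma dotM_M_mu mu A : inV mu -> sym A ->
  dotM (M_mu mu) A = 4^-1 * arr_dot (arr_pi A (mu_m mu)) (mu_m mu).
Proof.
move=> Vmu symA; set T := mu_m mu.
have TC i j k : T i j k = - T j i k by rewrite /T !mu_mE /coef (inVC Vmu) mxE.
pose P := \sum_a \sum_b A a b * \sum_i \sum_j T i j a * T i j b.
pose Q := \sum_a \sum_b A a b * \sum_i \sum_j T a i j * T b i j.
have LE : dotM (M_mu mu) A = - 2^-1 * Q + 4^-1 * P.
  rewrite dotME !mulr_sumr -big_split; apply: eq_bigr => a _ /=.
  rewrite !mulr_sumr -big_split; apply: eq_bigr => b _ /=.
  by rewrite mxE -/T; ring.
have E1 : \sum_i \sum_j \sum_k \sum_l A k l * T i j l * T i j k = P.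
  rewrite /P.
  under [RHS]eq_bigr => a _ do under eq_bigr => b _ do rewrite mulr_sumr.
  under [RHS]eq_bigr => a _ do rewrite exchange_big /=.
  rewrite [RHS]exchange_big /=; apply: eq_bigr => i _.
  under [RHS]eq_bigr => a _ do under eq_bigr => b _ do rewrite mulr_sumr.
  under [RHS]eq_bigr => a _ do rewrite exchange_big /=.
  rewrite [RHS]exchange_big /=; apply: eq_bigr => j _.
  by do 2!(apply: eq_bigr => ? _); ring.
have E2 : \sum_i \sum_j \sum_k \sum_l A l i * T l j k * T i j k = Q.
  rewrite /Q; apply: eq_bigr => i _.
  under [RHS]eq_bigr => b _ do rewrite mulr_sumr.
  rewrite [RHS]exchange_big /=; apply: eq_bigr => j _.
  under [RHS]eq_bigr => b _ do rewrite mulr_sumr.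
  rewrite [RHS]exchange_big /=; apply: eq_bigr => k _.
  by apply: eq_bigr => l _; rewrite -[A in LHS]symA mxE; ring.
have E3 : \sum_i \sum_j \sum_k \sum_l A l j * T i l k * T i j k = Q.
  rewrite -E2 exchange_big /=; do 4!(apply: eq_bigr => ? _).
  by rewrite [T _ _ _]TC [X in _ * X]TC; ring.
have -> : arr_dot (arr_pi A T) T = P - Q - Q.
  rewrite -{1}E1 -{1}E2 -E3 /arr_dot -!sumrB; apply: eq_bigr => i _.
  rewrite -!sumrB; apply: eq_bigr => j _.
  rewrite -!sumrB; apply: eq_bigr => k _.
  by rewrite /arr_pi !mulrBl !mulr_suml.
by rewrite LE; field.
Qed.

Section Block.
Variable S : 'M[R]_(d + n).
Hypothesis symS : sym S.
Hypothesis S_ur : ursubmx S = 0.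
Let S' := drsubmx S.

Lemma sym_drsubmx : sym S'.
Proof. by rewrite /sym /S' trmx_drsub symS. Qed.

Lemma block_dl i j : S (rshift d i) (lshift n j) = 0.
Proof.
rewrite -symS mxE.
by have /matrixP/(_ j i) := S_ur; rewrite !mxE.
Qed.

Lemma block_ur i j : S (lshift n j) (rshift d i) = 0.
Proof. by have /matrixP/(_ j i) := S_ur; rewrite !mxE. Qed.

(** [S] is block diagonal, so the sums over the isotropy indices vanish and projection to m commutes
    with the action. *)
Lemma mu_m_pi_act nu i j k : inV nu ->
  mu_m (pi_act S nu) i j k = arr_pi S' (mu_m nu) i j k.
Proof.
move=> Vnu; rewrite mu_mE coef_pi_act // /arr_pi !big_split_ord /=.
rewrite ![\sum_(_ < d) _]big1 ?add0r => [|l _|l _|l _]; last first.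
- by rewrite block_dl mul0r.
- by rewrite block_ur mul0r.
- by rewrite block_ur mul0r.
by congr (_ - _ - _); apply: eq_bigr => l _; rewrite !mu_mE !mxE.
Qed.

(** The m-parts of the eigenvectors that sum to [mu] satisfy the eigenvalue equation for [S'], with
    the same nonnegative eigenvalues. *)
Lemma dotM_M_mu_ge0 mu : Vge0 S mu -> 0 <= dotM (M_mu mu) S'.
Proof.
move=> VSmu; rewrite dotM_M_mu; [|exact: inV_Vge0 VSmu|exact: sym_drsubmx].
have [r [l [nu [H E]]]] := VSmu.
rewrite mulr_ge0 ?invr_ge0 ?ler0n //.
apply: (arr_pi_ge0 (l := l) (F := fun a => mu_m (nu a))).
- exact: sym_drsubmx.
- by move=> a; have [] := H a.
- move=> a i j k; have [Vnu _ eig] := H a.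
  by rewrite -mu_m_pi_act // eig !mu_mE /coef !fctE mxE.
- move=> i j k; rewrite mu_mE E /coef fct_sum2E summxE.
  by apply: eq_bigr => a _; rewrite mu_mE.
Qed.

(** [S] maps m to itself, so the pairing is the sum of the Killing form values at (S e_b, e_b) over
    the basis of m, and the image of [S] lies in the radical. *)
Lemma dotM_B_mu_eq0 mu :
  (forall c (x : 'cV[R]_(d + n)), x != 0 -> S *m x = c *: x -> 0 <= c) ->
  Vge0 S mu -> dotM (B_mu mu) S' = 0.
Proof.
move=> S_ge0 VSmu; have Vmu := inV_Vge0 VSmu.
rewrite dotME exchange_big big1 // => b _ /=.
transitivity (killing_form mu (S *m m_vec R d b) (m_vec R d b)); last first.
  exact: killing_form_image_eq0.
have -> : S *m m_vec R d b = \sum_a S' a b *: m_vec R d a.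
  rewrite mul_bvec big_split_ord /= big1 ?add0r => [|l _].
    by apply: eq_bigr => a _; rewrite !mxE.
  by rewrite block_ur scale0r.
rewrite killing_form_suml //; apply: eq_bigr => a _.
by rewrite mxE mulrC.
Qed.

End Block.

End ModifiedRicci.

(** * Lie algebras of vector fields *)

Section LieAlgebraOfFields.
Variables (R : realType) (n : nat) (M : manifold R n).
Implicit Types (X Y Z : vfield M).

Lemma tangent0 (p : M) (v : tvec M) : tangent p v -> v (fun=> 0) = 0.
Proof.
move=> [lin _ nsm].
(* Linearity settles the smooth case; otherwise the value is 0 by the convention in [tangent]. *)
have [sm|] := pselect (smooth (fun _ : M => 0 : R)); last exact: nsm.
have := lin 1 _ _ sm sm; have -> : (fun _ : M => 1 * 0 + 0 : R) = fun=> 0.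
  by apply/funext => x; rewrite mulr0 addr0.
by rewrite mul1r => /eqP; rewrite -subr_eq subrr eq_sym => /eqP.
Qed.

Lemma tangentB (p : M) (v : tvec M) f g : tangent p v -> smooth f -> smooth g ->
  v (fun x => f x - g x) = v f - v g.
Proof.
move=> [lin _ _] sf sg.
have -> : (fun x => f x - g x) = (fun x => -1 * g x + f x).
  by apply/funext => x; rewrite mulN1r addrC.
by rewrite lin // mulN1r addrC.
Qed.

Lemma lie_bracket_leibniz X Y Z :
  vector_field X -> vector_field Y -> vector_field Z ->
  lie_bracket X (lie_bracket Y Z)
  = lie_bracket (lie_bracket X Y) Z + lie_bracket Y (lie_bracket X Z).
Proof.
move=> [tX sX] [tY sY] [tZ sZ]; apply/funext => p; apply/funext => f.
rewrite !fctE.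
have [sf|nsf] := pselect (smooth f).
  rewrite /lie_bracket (tangentB (tX p)) ?(tangentB (tY p))
    ?(tangentB (tZ p)) //;
    try by [exact: sX (sX _ sf)|exact: sX (sY _ sf)|exact: sX (sZ _ sf)
           |exact: sY (sX _ sf)|exact: sY (sZ _ sf)
           |exact: sZ (sX _ sf)|exact: sZ (sY _ sf)].
  by ring.
(* On a non-smooth [f] all fields give 0, so nested brackets evaluate the outer field on the zero
   function; [null] records both values and passes to brackets. *)
pose null (W : vfield M) := forall q, W q f = 0 /\ W q (fun=> 0) = 0.
have nullB U W : null U -> null W -> null (lie_bracket U W).
  move=> nU nW q; rewrite /lie_bracket.
  have E (V : vfield M) g : (forall r, V r g = 0) -> (fun r => V r g) = fun=> 0.
    by move=> ?; exact/funext.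
  by rewrite !(E W) ?(E U) ?(proj2 (nU q)) ?(proj2 (nW q)) ?subrr // => r;
    have [] := nU r; have [] := nW r.
have nullT W : (forall q, tangent q (W q)) -> null W.
  by move=> tW q; split; [have [_ _ ->] := tW q|exact: tangent0 (tW q)].
have nX := nullT X tX; have nY := nullT Y tY; have nZ := nullT Z tZ.
have [-> _] := nullB _ _ nX (nullB _ _ nY nZ) p.
have [-> _] := nullB _ _ (nullB _ _ nX nY) nZ p.
have [-> _] := nullB _ _ nY (nullB _ _ nX nZ) p.
by rewrite addr0.
Qed.

Variable N : nat.
Implicit Types (e : 'I_N -> vfield M).

Lemma lincombD e x y : lincomb e (x + y) = lincomb e x + lincomb e y.
Proof.
rewrite /lincomb -big_split; apply: eq_bigr => i _.
by rewrite mxE scalerDl.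
Qed.

Lemma represents_jacobi e mu : represents e mu -> injective (lincomb e) ->
  (forall x, vector_field (lincomb e x)) -> jacobi mu.
Proof.
move=> rep inj vf X Y Z; apply: inj.
by rewrite lincombD !rep lie_bracket_leibniz.
Qed.

End LieAlgebraOfFields.

(** An element of the radical is Killing-orthogonal to the isotropy algebra, hence lies in m, the
    span of the last [n] basis vectors. *)
Lemma adapted_basis_complement (R : realType) (n d : nat) (M : manifold R n)
    (gg : set (vfield M)) (p : M) (e : 'I_(d + n) -> vfield M)
    (mu : bracket R (d + n)) (x : 'cV[R]_(d + n)) :
  injective (lincomb e) ->
  canonical_complement gg p e mu = range (lincomb (fun i => e (rshift d i))) ->
  (forall z, killing_form mu x z = 0) -> usubmx x = 0.
Proof.
move=> inj cE K.
have : canonical_complement gg p e mu (lincomb e x).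
  by exists x => // z _; exact: K.
rewrite cE => -[y _ yx].
have : lincomb e (col_mx 0 y) = lincomb e x.
  rewrite -yx /lincomb big_split_ord /= big1 ?add0r => [|i _].
    by apply: eq_bigr => i _; rewrite col_mxEd.
  by rewrite col_mxEu mxE scale0r.
by move/inj => <-; rewrite col_mxKu.
Qed.

(** * Trace of the moment map and spectrum of [beta_plus] on a stratum *)

Section MomentSpectrum.
Variables (R : realType) (N : nat).
Implicit Types (mu lam : bracket R N) (beta k : 'M[R]_N).

(** Pair the moment map with the identity and use pi(Id) mu = - mu. *)
Lemma trace_moment mu : inV mu -> mu != 0 -> \tr (moment mu) = -1.
Proof.
move=> Vmu mu0; have N0 : dotV mu mu != 0 by rewrite gt_eqF // dotV_gt0.
have := @momentP R N mu Vmu 1%:M (trmx1 _ _).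
rewrite dotMC dotM_scalar mul1r => ->.
by rewrite pi_act1 // dotVZl mulN1r mulrN mulVf.
Qed.

Lemma critical_beta_plus lam : critical lam ->
  pi_act (beta_plus (moment lam)) lam = 0.
Proof.
move=> [Vlam lam0 /(gradient_energy Vlam lam0)/esym/eqP].
rewrite scaler_eq0 mulf_eq0 invr_eq0 pnatr_eq0 /= => /orP[|/eqP //].
by rewrite gt_eqF // dotV_gt0.
Qed.

Lemma beta_plus_conj beta k : orthogonal_mx k ->
  beta_plus (k *m beta *m invmx k) = k *m beta_plus beta *m invmx k.
Proof.
move=> ok; have ok' : k^T *m k = 1%:M by rewrite (mulmx1C ok).
have ku : k \in unitmx by case: (mulmx1_unit ok).
have kV : invmx k = k^T by rewrite -[LHS]mul1mx -ok' mulmxK.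
rewrite /beta_plus.
have -> : dotM (k *m beta *m invmx k) (k *m beta *m invmx k) = dotM beta beta.
  rewrite /dotM kV !trmx_mul trmxK !mulmxA -[_ *m k^T *m k]mulmxA ok' mulmx1.
  by rewrite -!mulmxA mxtrace_mulC -!mulmxA ok' mulmx1.
by rewrite kV mulmxDr mulmxDl mul_mx_scalar -scalemxAl ok scalemx1.
Qed.

(** The limit [lam] is a critical Lie bracket whose moment is conjugate to [beta] by [k]; thus
    [k *m x] is an eigenvector of its [beta_plus] with the same eigenvalue. *)
Lemma stratum_eigenvalue_ge0 beta mu : jacobi mu -> stratum beta mu ->
  forall c (x : 'cV[R]_N), x != 0 -> beta_plus beta *m x = c *: x -> 0 <= c.
Proof.
move=> Jmu [Vmu [mu0 [f [lam [f0 flow conv crit [k ok mk]]]]]] c x x0 Sx.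
have [Vlam lam0 _] := crit.
have ku : k \in unitmx by case: (mulmx1_unit ok).
apply: (@derivation_eigenvalue_ge0 _ _ lam (k *m x)) => //.
- by apply: flow_limit_jacobi conv _ => //; rewrite f0.
- exact: critical_beta_plus.
- by apply: contra x0 => /eqP E; rewrite -[x](mulKmx ku) E mulmx0.
- by rewrite mk beta_plus_conj // -!mulmxA mulKmx // Sx scalemxAr.
Qed.

End MomentSpectrum.

(** * The inequality and its equality case *)

Theorem corollary6p3 (R : realType) (n d : nat) (M : manifold R n)
    (gg : set (vfield M)) (p : M) (gbar : metric M) (nabla : connection M)
    (e : 'I_(d + n) -> vfield M) (mug : bracket R (d + n))
    (beta : 'M[R]_(d + n)) (mu : bracket R (d + n))
    (Hhom : homogeneous_manifold gg) (Hnonflat : non_flat gg)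
    (Hgbar : G_invariant gg gbar) (Hnabla : levi_civita gbar nabla)
    (Hmug : represents e mug)
    (He : adapted_orthonormal_basis gg p gbar nabla e mug)
    (Hbeta : exists2 muC, critical muC & beta = moment muC)
    (Hmug_stratum : stratum beta mug) (Hmug_Vge0 : Vge0 (beta_plus beta) mug)
    (Hmu_orbit : orbit_H gg p e mug mu) (Hmu_Vge0 : Vge0 (beta_plus beta) mu)
    (Hscal : scal_star mu < 0) :
  normM (Ric_star mu) >= `|scal_star mu| * normM (beta_m beta) /\
  (normM (Ric_star mu) = `|scal_star mu| * normM (beta_m beta) <->
   Ric_star mu = - scal_star mu *: beta_m beta).
Proof.
have [[inj ggE] _ [_ cE] _ _] := He.
have vf x : vector_field (lincomb e x).
  have : gg (lincomb e x) by rewrite ggE; exists x.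
  by case: Hgbar => _ H /H[].
have Jmug := represents_jacobi Hmug inj vf.
have S_ge0 := stratum_eigenvalue_ge0 Jmug Hmug_stratum.
have [muC [VmuC muC0 _] betaE] := Hbeta.
have symb : sym beta by rewrite betaE; exact: moment_sym.
pose s := dotM beta beta; pose S := beta_plus beta.
have symS : sym S by rewrite /sym /S /beta_plus linearD /= symb tr_scalar_mx.
(* Column [j] of [S] is the image of a basis vector, hence in the radical of the Killing form of
   [mug], and so has no isotropy component. *)
have S_up i j : S (lshift n i) j = 0.
  have := adapted_basis_complement inj cE
    (fun z => killing_form_image_eq0 (bvec R j) z symS S_ge0 Hmug_Vge0).
  by move/matrixP/(_ i 0); rewrite [S _ j]entry_bvec !mxE.
have S_ur : ursubmx S = 0.
  by apply/matrixP => i j; rewrite [LHS]mxE [LHS]mxE S_up mxE.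
have Ric_S : 0 <= dotM (Ric_star mu) (drsubmx S).
  rewrite /Ric_star -scaleNr dotMDl dotMZl dotM_B_mu_eq0 // mulr0 addr0.
  exact: dotM_M_mu_ge0.
pose b := drsubmx beta; pose t := \tr b.
have drS : drsubmx S = b + s%:M.
  apply/matrixP => i j; rewrite !mxE (inj_eq (@rshift_inj _ _)).
  by [].
have betaS i j : beta i j = S i j - s *+ (i == j).
  by rewrite /S /beta_plus !mxE addrK.
have b_ul i j : beta (lshift n i) (lshift n j) = - s *+ (i == j).
  by rewrite betaS S_up sub0r (inj_eq (@lshift_inj _ _)) mulNrn.
have b_ur i j : beta (lshift n i) (rshift d j) = 0.
  by rewrite betaS S_up eq_lrshift mulr0n subr0.
have b_dl i j : beta (rshift d i) (lshift n j) = 0.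
  by rewrite -symb mxE b_ur.
have ul : ulsubmx beta = (- s)%:M.
  by apply/matrixP => i j; rewrite !mxE b_ul.
(* The isotropy block of [beta] is - s Id of size [d], and the trace of [beta] is -1. *)
have tE : t = d%:R * s - 1.
  have := trace_moment VmuC muC0; rewrite -betaE -[X in \tr X]submxK.
  rewrite mxtrace_block ul mxtrace_scalar -mulr_natl => <-.
  by rewrite -/b -/t; ring.
have sE : s = d%:R * s ^+ 2 + dotM b b.
  rewrite {1}/s !dotME big_split_ord /=; congr (_ + _); last first.
    apply: eq_bigr => i _; rewrite big_split_ord /= big1 ?add0r => [|j _].
      by apply: eq_bigr => j _; rewrite !mxE.
    by rewrite b_dl mul0r.
  transitivity (\sum_(i < d) s ^+ 2).
    apply: eq_bigr => i _; rewrite big_split_ord /= addrC big1 ?add0r => [|j _].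
      rewrite (bigD1 i) //= big1 ?addr0 => [|j ji].
        by rewrite b_ul eqxx mulr1n mulrNN.
      by rewrite b_ul eq_sym (negPf ji) mulr0n mul0r.
    by rewrite b_ur mul0r.
  by rewrite sumr_const card_ord mulr_natl.
(* |b|^2 = s - d s^2 = s (1 - d s). *)
have bb : dotM b b = - t * s by rewrite tE; nra.
have Ric_b : 0 <= dotM (Ric_star mu) b + s * scal_star mu.
  move: Ric_S; rewrite drS dotMC dotMDl dotM_scalar -/(scal_star mu).
  by rewrite dotMC.
have s_gt0 : 0 < s.
  rewrite lt_neqAle dotM_ge0 andbT eq_sym; apply/eqP => s0.
  have b0 : b = 0 by apply: dotM_eq0; rewrite bb s0 mulr0.
  by move: tE; rewrite /t b0 linear0 s0 mulr0 sub0r => /eqP;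
     rewrite eq_sym oppr_eq0 oner_eq0.
(* If [t = 0] then [b = 0], and [Ric_b] becomes [0 <= s * scal_star mu], contradicting [Hscal]. *)
have t_lt0 : t < 0.
  rewrite lt_neqAle; apply/andP; split.
    apply/eqP => t0.
    have b0 : b = 0 by apply: dotM_eq0; rewrite bb t0 oppr0 mul0r.
    move: Ric_b; rewrite b0 dotMC /dotM mul0mx linear0 add0r.
    by rewrite leNgt pmulr_rlt0 // Hscal.
  have : 0 <= - t * s by rewrite -bb dotM_ge0.
  by rewrite pmulr_lge0 // oppr_ge0.
set bm := beta_m beta; set Ric := Ric_star mu; set c := - scal_star mu.
have c_gt0 : 0 < c by rewrite oppr_gt0.
have absc : `|scal_star mu| = c by rewrite ltr0_norm.
(* The square norm of [beta_m beta], namely |b|^2 / t^2 with |b|^2 = - t s. *)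
pose q := s / - t.
have q_gt0 : 0 < q by rewrite divr_gt0 // oppr_gt0.
have bmq : dotM bm bm = q.
  rewrite /bm /beta_m -/b -/t dotMZl dotMZr bb /q.
  by field; rewrite lt_eqF.
have Ricbm : c * q <= dotM Ric bm.
  rewrite /bm /beta_m -/b -/t dotMZr /q mulrA [_^-1 * _]mulrC.
  by rewrite ler_pM2r ?invr_gt0 ?oppr_gt0 // /c mulNr -subr_ge0 opprK mulrC.
have Ric_diff : dotM (Ric - c *: bm) (Ric - c *: bm)
    = dotM Ric Ric - 2 * c * dotM Ric bm + c ^+ 2 * q.
  by rewrite dotM_sqrB bmq.
have Ric_ge : c ^+ 2 * q <= dotM Ric Ric.
  have := dotM_ge0 (Ric - c *: bm); rewrite Ric_diff; nra.
have rhsE : c * normM bm = Num.sqrt (c ^+ 2 * q).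
  by rewrite /normM bmq (sqrtrM q (sqr_ge0 c)) sqrtr_sqr gtr0_norm.
rewrite absc; split; first by rewrite rhsE ler_wsqrtr.
split=> [|->]; last first.
  rewrite rhsE /normM dotMZl dotMZr bmq; congr Num.sqrt; ring.
rewrite rhsE => /(congr1 (fun x => x ^+ 2)); rewrite !sqr_sqrtr ?dotM_ge0 //;
  last by rewrite mulr_ge0 ?sqr_ge0 ?ltW.
(* With |Ric|^2 = c^2 q, the square norm of the difference is 2 c (c q - <Ric, bm>), which [Ricbm]
   makes nonpositive. *)
move=> E; apply/eqP; rewrite -subr_eq0; apply/eqP/dotM_eq0/eqP.
rewrite eq_le dotM_ge0 andbT Ric_diff E; nra.
Qed.
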